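(* Let $n\ge 1$, let $A,B\in\mathbb{R}^{n\times n}$ with $B$ invertible, let $Q\in\mathbb{R}^{n\times n}$ be positive definite, and consider the system $x_{t+1}=Ax_t+Bu_t+w_t$, $t\ge 0$, in $\mathbb{R}^n$, where $\{w_t\}_{t\ge 0}$ is i.i.d., zero-mean, with covariance matrix $\Sigma=E[w_0w_0^\top]$, and $w_0$ has a probability density with respect to Lebesgue measure that is positive everywhere on $\mathbb{R}^n$. Suppose that $E[\|w_0\|_\infty^\beta]<\infty$ for some $\beta>2$, and that $x_0$ is independent of $\{w_t\}_{t\ge 0}$ with $E[\|x_0\|_\infty^\beta]<\infty$. Then for every $\varepsilon\in(0,\beta-2)$ there exists a joint coding and control scheme (that is, for every sufficiently large channel capacity $C$, a causal zero-delay fixed-rate encoder and controller for the noiseless channel of capacity $C$ bits) such that, as $C\to\infty$, $$\limsup_{T\to\infty}\frac1T E\Big[\sum_{t=0}^{T-1}x_t^\top Qx_t\Big]-\operatorname{tr}(Q\Sigma)=O\!\left(\frac{2^{\left(\frac{4}{\beta-\varepsilon}\right)\frac1n C}}{2^{\frac2n C}}\right).$$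
   Context: $\|x\|_\infty=\max_i|x^i|$. The discrete noiseless channel of capacity $C$ bits has a finite alphabet $\mathcal M$ with $|\mathcal M|=\lfloor 2^C\rfloor$. A joint coding and control scheme for capacity $C$ consists of: an encoder, i.e. a sequence of measurable maps $\eta_t:\mathcal M^{t}\times(\mathbb{R}^n)^{t+1}\to\mathcal M$, $t\ge0$, which at time $t$ transmits $q_t=\eta_t(q_0,\dots,q_{t-1},x_0,\dots,x_t)$; and a controller, i.e. a sequence of maps $\gamma_t:\mathcal M^{t+1}\to\mathbb{R}^n$, $t\ge 0$, which applies $u_t=\gamma_t(q_0,\dots,q_t)$. The symbol $q_t$ is received without error or delay. For nonnegative functions $f,g$ of $C$, $f=O(g)$ as $C\to\infty$ means that there is a constant $c>0$ with $f(C)\le c\,g(C)$ for all sufficiently large $C$. The quantity $\operatorname{tr}(Q\Sigma)$ is the optimal cost when the controller observes $x_t$ fully. *)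

(* Defs.v *)
From HB Require Import structures.
From mathcomp Require Import all_boot all_order all_algebra.
From mathcomp Require Import all_classical all_reals all_analysis.

Set Implicit Arguments.
Unset Strict Implicit.
Unset Printing Implicit Defensive.

Import Order.TTheory GRing.Theory Num.Theory.
Import numFieldNormedType.Exports.

Local Open Scope classical_set_scope.
Local Open Scope ring_scope.

(* Vectors of R^n are column matrices 'cV[R]_n. Real matrices carry the Borel
   sigma-algebra, generated by the coordinate maps (the matrix counterpart of
   the library's sigma-algebra on n.-tuple T). *)
Definition mx_display : measure_display.
Proof. exact: default_measure_display. Qed.

Section mx_measurable.
Variables (R : realType) (m n : nat).

Definition mx_coord_sets : set_system 'M[R]_(m, n) :=
  \bigcup_(ij in [set: 'I_m * 'I_n])
    preimage_set_system setT (fun A : 'M[R]_(m, n) => A ij.1 ij.2)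
      (@measurable _ R).

Let mx_set0 : <<s mx_coord_sets >> set0.
Proof. exact: sigma_algebra0. Qed.

Let mx_setC X : <<s mx_coord_sets >> X -> <<s mx_coord_sets >> (~` X).
Proof. exact: sigma_algebraC. Qed.

Let mx_bigcup (F : (set 'M[R]_(m, n))^nat) :
  (forall i, <<s mx_coord_sets >> (F i)) ->
  <<s mx_coord_sets >> (\bigcup_i (F i)).
Proof. exact: sigma_algebra_bigcup. Qed.

HB.instance Definition _ := @isMeasurable.Build mx_display 'M[R]_(m, n)
  <<s mx_coord_sets >> mx_set0 mx_setC mx_bigcup.

Lemma measurable_coord i j :
  measurable_fun [set: 'M[R]_(m, n)] (fun A : 'M[R]_(m, n) => A i j).
Proof.
move=> _ Y mY; apply: sub_sigma_algebra.
by exists (i, j) => //; exists Y.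
Qed.

Lemma measurable_mxP d (T : measurableType d) (f : T -> 'M[R]_(m, n)) :
  (forall i j, measurable_fun [set: T] (fun t => f t i j)) ->
  measurable_fun [set: T] f.
Proof.
move=> mf; apply: (@measurability _ _ _ _ [set: T] f mx_coord_sets) => //.
move=> _ [_ [[i j] _ [Y mY <-]] <-].
rewrite [X in measurable X](_ : _ = setT `&` (fun t => f t i j) @^-1` Y).
  by apply: mf.
by rewrite !setTI.
Qed.

End mx_measurable.

(* n-dimensional Lebesgue measure, as the iterated product of the
   one-dimensional one: R^(n+1) is identified with R^n x R by putting the
   last component of the pair on top of the column. *)
Section lebesgue_cV.
Variable R : realType.

Definition cons_cV n (p : 'cV[R]_n * measurableTypeR R) : 'cV[R]_n.+1 :=
  col_mx (p.2)%:M p.1.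

Lemma measurable_cons_cV n : measurable_fun setT (@cons_cV n).
Proof.
apply: measurable_mxP => i j; rewrite /cons_cV.
case: (splitP (i : 'I_(1 + n))) => k ik.
  have -> : i = lshift n k by exact: val_inj.
  under eq_fun do rewrite (@col_mxEu _ 1 n 1) !ord1 mxE eqxx mulr1n.
  exact: measurable_snd.
have -> : i = rshift 1 k by exact: val_inj.
under eq_fun do rewrite (@col_mxEd _ 1 n 1).
apply: (measurableT_comp (measurable_coord k j)); exact: measurable_fst.
Qed.

Section step.
Variables (n : nat) (mu : {measure set 'cV[R]_n -> \bar R}).

Definition lebesgue_step : set 'cV[R]_n.+1 -> \bar R :=
  pushforward (mu \x (@lebesgue_measure R))%E (@cons_cV n).

Let step0 : lebesgue_step set0 = 0%E.
Proof. by rewrite /lebesgue_step /pushforward preimage_set0 measure0. Qed.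

Let step_ge0 X : (0 <= lebesgue_step X)%E.
Proof. by rewrite /lebesgue_step /pushforward measure_ge0. Qed.

Let step_sigma_additive : semi_sigma_additive lebesgue_step.
Proof.
rewrite /lebesgue_step.
by apply: measure_semi_sigma_additive; exact: measurable_cons_cV.
Qed.

HB.instance Definition _ := isMeasure.Build _ _ _ lebesgue_step
  step0 step_ge0 step_sigma_additive.

End step.

Fixpoint lebesgue_cV n : {measure set 'cV[R]_n -> \bar R} :=
  if n is n'.+1 then lebesgue_step (lebesgue_cV n') else \d_ (0 : 'cV[R]_0).

End lebesgue_cV.

Lemma lebesgue_cV_box (R : realType) n (X : 'I_n -> set (measurableTypeR R)) :
  (forall i, measurable (X i)) ->
  lebesgue_cV R n [set v | forall i, X i (v i 0)] =
  (\prod_(i < n) lebesgue_measure (X i))%E.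
Proof.
elim: n X => [|n IH] X mX /=.
  rewrite big_ord0 diracE mem_set// => -[]//.
rewrite big_ord_recl /lebesgue_step /pushforward.
set Y := [set v : 'cV[R]_n | forall i, X (lift ord0 i) (v i 0)].
have mY : measurable Y.
  have -> : Y = \bigcap_(i in [set: 'I_n]) ((fun v : 'cV[R]_n => v i 0) @^-1` X (lift ord0 i)).
    by apply/seteqP; split => [v Yv i _|v Yv i]; [exact: Yv|exact: (Yv i I)].
  apply: fin_bigcap_measurable => // i _; rewrite -[X in measurable X]setTI.
  by have := @measurable_coord R n 1 i 0 measurableT (X (lift ord0 i)) (mX _).
rewrite [X in product_measure1 _ _ X](_ : _ = Y `*` X ord0); last first.
  have e0 (p : 'cV[R]_n * measurableTypeR R) : cons_cV p ord0 0 = p.2.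
    have -> : (ord0 : 'I_n.+1) = lshift n (ord0 : 'I_1) by exact: val_inj.
    by rewrite /cons_cV (@col_mxEu _ 1 n 1) mxE eqxx mulr1n.
  have e1 (p : 'cV[R]_n * measurableTypeR R) i : cons_cV p (lift ord0 i) 0 = p.1 i 0.
    have -> : lift (ord0 : 'I_n.+1) i = rshift 1 i by exact: val_inj.
    by rewrite /cons_cV (@col_mxEd _ 1 n 1).
  apply/seteqP; split => p /=.
    by move=> h; split; [move=> i; rewrite -e1|rewrite -e0]; exact: h.
  move=> [h h0] i; case: (unliftP ord0 i) => [j|] ->; first by rewrite e1; exact: h.
  by rewrite e0.
rewrite product_measure1E// muleC; congr (_ * _)%E; exact: (IH (fun i => X (lift ord0 i))).
Qed.

Section probability_notions.
Local Open Scope ereal_scope.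
Context {d d' : measure_display} {T : measurableType d} {U : measurableType d'}
  {R : realType}.
Variable P : probability T R.

(* mutual independence: product rule for every finite subfamily *)
Definition mutually_independent (I : choiceType) (X : I -> {RV P >-> U}) : Prop :=
  forall (s : seq I) (A : I -> set U), uniq s ->
    (forall i, measurable (A i)) ->
    P (\bigcap_(i in [set` s]) X i @^-1` A i) =
    \prod_(i <- s) P (X i @^-1` A i).

Definition iid (X : nat -> {RV P >-> U}) : Prop :=
  mutually_independent X /\
  forall t (A : set U), measurable A -> P (X t @^-1` A) = P (X 0%N @^-1` A).

Definition sigma_family (I : Type) (X : I -> {RV P >-> U}) : set_system T :=
  <<s \bigcup_(i in [set: I]) preimage_set_system setT (X i) measurable >>.

Definition independent_of_family (I : Type) (Y : {RV P >-> U})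
    (X : I -> {RV P >-> U}) : Prop :=
  forall (A : set U) (E : set T), measurable A -> sigma_family X E ->
    P (Y @^-1` A `&` E) = P (Y @^-1` A) * P E.

End probability_notions.

Section random_vectors.
Context {d : measure_display} {T : measurableType d} {R : realType}.
Variables (P : probability T R) (n : nat).

Definition zero_mean (X : {RV P >-> 'cV[R]_n}) : Prop :=
  forall i, ('E_P[fun omega => X omega i 0%R] = 0)%E.

(* S = E[X X^T], for a zero-mean X *)
Definition has_covariance (X : {RV P >-> 'cV[R]_n}) (S : 'M[R]_n) : Prop :=
  forall i j, ('E_P[fun omega => (X omega *m (X omega)^T)%R i j] = (S i j)%:E)%E.

Definition has_positive_density (X : {RV P >-> 'cV[R]_n}) : Prop :=
  exists p : 'cV[R]_n -> R,
    [/\ measurable_fun setT p, forall v, 0 < p v &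
      forall A, measurable A ->
        P (X @^-1` A) = (\int[lebesgue_cV R n]_(v in A) (p v)%:E)%E].

(* The norm of the library on matrices is max_(i,j) `|x i j|. *)
Definition finite_moment (beta : R) (X : {RV P >-> 'cV[R]_n}) : Prop :=
  ('E_P[fun omega => (`|X omega| `^ beta)%R] < +oo)%E.

End random_vectors.

Definition quad_form (R : realType) n (Q : 'M[R]_n) (x : 'cV[R]_n) : R :=
  (x^T *m Q *m x) 0 0.

Definition posdefmx (R : realType) n (Q : 'M[R]_n) : Prop :=
  Q^T = Q /\ forall x : 'cV[R]_n, x != 0 -> 0 < quad_form Q x.

Definition alphabet_size (R : realType) (C : R) : nat := Num.truncn (2 `^ C).

(* A joint coding and control scheme over the alphabet M. As M is finite,
   [encoder_measurable] is measurability of the encoder on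
   M^t x (R^n)^(t+1), with M carrying the discrete sigma-algebra. *)
Record scheme (R : realType) (M : finType) (n : nat) := Scheme {
  encoder : forall t, t.-tuple M -> t.+1.-tuple 'cV[R]_n -> M;
  encoder_measurable : forall t (q : t.-tuple M) (a : M),
    measurable [set x : t.+1.-tuple 'cV[R]_n | encoder q x = a];
  controller : forall t, t.+1.-tuple M -> 'cV[R]_n
}.

Section closed_loop.
Context {R : realType} {M : finType} {n : nat}.
Variables (A B : 'M[R]_n) (S : scheme R M n).
Variables (x0 : 'cV[R]_n) (w : nat -> 'cV[R]_n).

(* the histories (q_0, ..., q_(t-1)) and (x_0, ..., x_t) *)
Fixpoint history t : t.-tuple M * t.+1.-tuple 'cV[R]_n :=
  if t is t'.+1 then
    let: (q, x) := history t' in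
    let q' := [tuple of rcons q (encoder S q x)] in
    let u := controller S q' in
    (q', [tuple of rcons x (A *m tnth x ord_max + B *m u + w t')])
  else ([tuple], [tuple x0]).

Definition state t : 'cV[R]_n := tnth (history t).2 ord_max.

Definition symbol t : M := encoder S (history t).1 (history t).2.

Definition control t : 'cV[R]_n := controller S (history t.+1).1.

Lemma state0 : state 0 = x0.
Proof. by rewrite /state (tnth_nth 0). Qed.

Lemma stateS t : state t.+1 = A *m state t + B *m control t + w t.
Proof.
rewrite /state /control /=; case: (history t) => q x /=.
by rewrite (tnth_nth 0) /= nth_rcons size_tuple ltnn eqxx.
Qed.

Lemma history_states t : (history t).2 = [tuple state i | i < t.+1].
Proof.
elim: t => [|t IH].
  by apply: eq_from_tnth => i; rewrite tnth_mktuple ord1 state0 (tnth_nth 0).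
apply: eq_from_tnth => i; rewrite tnth_mktuple.
have [it|] := ltnP i t.+1.
  have := congr1 (fun z => tnth z (Ordinal it)) IH.
  rewrite tnth_mktuple /= => <-.
  case: (history t) => q x /=.
  by rewrite !(tnth_nth 0) /= nth_rcons size_tuple it.
move=> ti; have -> : i = ord_max by apply/val_inj/eqP; rewrite eqn_leq leq_ord.
by rewrite /state.
Qed.

Lemma history_symbols t : (history t).1 = [tuple symbol i | i < t].
Proof.
elim: t => [|t IH]; first by apply: eq_from_tnth => -[].
apply: eq_from_tnth => i; rewrite tnth_mktuple.
have [it|] := ltnP i t.
  have := congr1 (fun z => tnth z (Ordinal it)) IH.
  rewrite tnth_mktuple /= => <-.
  case: (history t) => q x /=.
  by rewrite !(tnth_nth (encoder S q x)) /= nth_rcons size_tuple it.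
move=> ti; have -> : i = ord_max by apply/val_inj/eqP; rewrite eqn_leq leq_ord.
rewrite /symbol /=; case: (history t) => q x /=.
by rewrite (tnth_nth (encoder S q x)) /= nth_rcons size_tuple ltnn eqxx.
Qed.

End closed_loop.

Section average_cost.
Context {d : measure_display} {T : measurableType d} {R : realType}.
Variable P : probability T R.
Context {M : finType} {n : nat}.
Variables (A B Q : 'M[R]_n) (x0 : {RV P >-> 'cV[R]_n})
  (w : nat -> {RV P >-> 'cV[R]_n}).
Variable S : scheme R M n.

Definition average_cost : \bar R :=
  limn_esup (fun N : nat => (N%:R^-1)%:E *
    'E_P[fun omega => (\sum_(0 <= t < N)
           quad_form Q (state A B S (x0 omega) (w^~ omega) t))%R])%E.

End average_cost.

(* f = O(g) as C -> +oo, a relation between (eventually) nonnegative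
   functions *)
Definition bigO_pinfty (R : realType) (f g : R -> R) : Prop :=
  exists2 c : R, 0 < c & \forall C \near +oo_R, 0 <= f C <= c * g C.

(* Main.v *)
Require Import Defs.
From HB Require Import structures.
From mathcomp Require Import all_boot all_order all_algebra.
From mathcomp Require Import all_classical all_reals all_analysis.
From mathcomp Require Import measurable_realfun ring lra.

(**
Take u_t = - B^-1 A y_t, where y_t is the reconstruction of x_t, so that
x_{t+1} = A e_t + w_t with e_t = x_t - y_t. As w_t is centred and independent
of e_t, the cost of stage t+1 exceeds tr(Q Sigma) by E[(A e_t)^T Q (A e_t)],
and it suffices to bound the average of E|e_t|^2.

The quantizer is a grid with K^n cells on the box of radius l_t, where
l_t = L rho^j. If x_t is covered then |e_t| <= l_t / K and j decreases by one;
otherwise an overflow symbol is sent, y_t = 0, and j increases by one. With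
V_t = l_t^2 / K^2 + |x_t|^beta l_t^(2-beta) [|x_t| > l_t] one has, for a
constant rho and along every trajectory, |e_t|^2 <= V_t and
V_{t+1} <= 3/4 V_t + L^2 / K^2 + 2^beta |w_t|^beta L^(2-beta).
The choice L = K^(2/beta) balances the two forcing terms at K^(4/beta - 2),
and K is about 2^(C/n).
*)

Set Implicit Arguments.
Unset Strict Implicit.
Unset Printing Implicit Defensive.

Import Order.TTheory GRing.Theory Num.Theory.
Import numFieldNormedType.Exports.

Local Open Scope classical_set_scope.
Local Open Scope ring_scope.

(** * Inequalities for real powers and contractive recursions *)

Lemma ler0_powR (R : realType) (p u v : R) :
  p <= 0 -> 0 < u -> u <= v -> v `^ p <= u `^ p.
Proof.
move=> p0 u0 uv; rewrite -(opprK p) powRN [leRHS]powRN.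
rewrite lef_pV2 ?posrE ?powR_gt0 ?(lt_le_trans u0 uv)//.
apply: ge0_ler_powR; rewrite ?nnegrE//; first by rewrite oppr_ge0.
  exact: ltW.
exact: ltW (lt_le_trans u0 uv).
Qed.

(** The sum is at most twice the larger of the two terms. *)
Lemma powRD_le (R : realType) (p u v : R) : 0 <= p -> 0 <= u -> 0 <= v ->
  (u + v) `^ p <= 2 `^ p * (u `^ p + v `^ p).
Proof.
move=> p0 u0 v0.
have H (x y : R) : 0 <= x -> x <= y ->
    (x + y) `^ p <= 2 `^ p * (x `^ p + y `^ p).
  move=> x0 xy; have y0 := le_trans x0 xy.
  apply: (@le_trans _ _ (2 `^ p * y `^ p)).
    by rewrite -powRM//; apply: ge0_ler_powR; rewrite ?nnegrE; lra.
  by rewrite ler_wpM2l ?powR_ge0// lerDr powR_ge0.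
have [uv|/ltW vu] := lerP u v; first exact: H.
by rewrite addrC [X in _ * X]addrC; exact: H.
Qed.

Lemma sum_contraction_le (R : realFieldType) (F g : nat -> R) N :
  (forall t, 0 <= F t) -> (forall t, F t.+1 <= 3 / 4 * F t + g t) ->
  \sum_(0 <= t < N) F t <= 4 * (F 0%N + \sum_(0 <= t < N) g t).
Proof.
move=> F0 FS.
(* The term [4 * F N] closes the induction: [F N + 4 * F N.+1 <= 4 * F N + 4 * g N] is the recursion
   itself. The constant is [1 / (1 - 3 / 4)]. *)
suff : \sum_(0 <= t < N) F t + 4 * F N <= 4 * (F 0%N + \sum_(0 <= t < N) g t).
  by have := F0 N; lra.
elim: N => [|N IH]; first by rewrite !big_geq//; lra.
by rewrite !big_nat_recr//=; have := FS N; lra.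
Qed.

(** * One step of the Lyapunov function *)

Section lyapunov.
Context {R : realType}.
Variables p K : R.
Implicit Types l y w : R.

(* The exponent 2 - p makes this drop by the factor rho^(2-p) when l is
   multiplied by rho, which beats the growth a^p of y^p once rho is large. *)
Definition overshoot (l y : R) : R :=
  if l < y then y `^ p * l `^ (2 - p) else 0.

Definition lyapunov (l y : R) : R := l ^+ 2 / K ^+ 2 + overshoot l y.

Lemma overshoot_ge0 l y : 0 <= overshoot l y.
Proof. by rewrite /overshoot; case: ifP => // _; rewrite mulr_ge0 ?powR_ge0. Qed.

Lemma overshoot_le l y : overshoot l y <= y `^ p * l `^ (2 - p).
Proof. by rewrite /overshoot; case: ifP => // _; rewrite mulr_ge0 ?powR_ge0. Qed.

Lemma lyapunov_ge_width l y : l ^+ 2 / K ^+ 2 <= lyapunov l y.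
Proof. by rewrite /lyapunov lerDl overshoot_ge0. Qed.

Lemma lyapunov_ge0 l y : 0 <= lyapunov l y.
Proof.
by apply: le_trans (lyapunov_ge_width l y); rewrite divr_ge0// sqr_ge0.
Qed.

Hypothesis p2 : 2 < p.

(** Write [y ^+ 2] as the product of the powers [p] and [2 - p] of [y]; the second exponent is
    negative, so replacing [y] by the smaller [l] there increases the product. *)
Lemma sqr_le_overshoot l y : 0 < l -> l < y -> y ^+ 2 <= overshoot l y.
Proof.
move=> l0 ly; rewrite /overshoot ly/=.
have y0 := lt_trans l0 ly.
have -> : y ^+ 2 = y `^ p * y `^ (2 - p).
  rewrite -powRD; last by rewrite (gt_eqF y0) implybT.
  by rewrite subrKC powR_mulrn// ltW.
apply: ler_wpM2l; first exact: powR_ge0.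
apply: ler0_powR => //; last exact: ltW.
by rewrite subr_le0 ltW.
Qed.

Lemma sqr_le_lyapunov l y : 0 < l -> l < y -> y ^+ 2 <= lyapunov l y.
Proof.
move=> l0 ly; apply: le_trans (sqr_le_overshoot l0 ly) _.
by rewrite /lyapunov lerDr divr_ge0// sqr_ge0.
Qed.

Variables a rho L : R.
Hypotheses (a1 : 1 <= a) (rho2 : 2 <= rho) (L0 : 0 < L).
Hypothesis rhop : 2 `^ p * a `^ p * rho `^ (2 - p) <= 2^-1.
Hypothesis Krho : 2 * a * rho <= K.

Let K0 : 0 < K.
Proof.
have := (a1, rho2) => -[? ?].
by apply: lt_le_trans Krho; rewrite !mulr_gt0//; lra.
Qed.

Let width_factor : rho ^+ 2 / K ^+ 2 <= 4^-1.
Proof.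
have := (a1, rho2) => -[? ?]; have ? := K0.
rewrite ler_pdivrMr ?exprn_gt0//.
have : (2 * rho) ^+ 2 <= K ^+ 2.
  rewrite ler_pXn2r ?nnegrE//; [|lra|exact: ltW].
  by apply: le_trans Krho; nra.
by rewrite exprMn; lra.
Qed.

(** On overflow the old overshoot pays for everything. The enlarged width term costs a quarter of
    it, because [rho ^+ 2 / K ^+ 2 <= 1 / 4] and [l ^+ 2 <= y ^+ 2]; the new overshoot costs half of
    it by the choice of [rho], plus a pure noise term. *)
Lemma lyapunov_overflow l y w y' : L <= l -> l < y -> 0 <= w -> 0 <= y' ->
  y' <= a * y + w ->
  lyapunov (rho * l) y' <=
    3 / 4 * lyapunov l y + (L ^+ 2 / K ^+ 2 + 2 `^ p * w `^ p * L `^ (2 - p)).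
Proof.
move=> Ll ly w0 y'0 y'le.
have := (p2, a1, rho2, L0) => -[[[? ?] ?] ?]; have ? := K0.
have l0 : 0 < l by lra.
have y0 : 0 < y by lra.
have p0 : 0 <= p by lra.
have rho0 : 0 <= rho by lra.
have h1 : (rho * l) ^+ 2 / K ^+ 2 <= 4^-1 * overshoot l y.
  rewrite exprMn mulrAC; apply: ler_pM; rewrite ?divr_ge0 ?sqr_ge0//.
  apply: le_trans (sqr_le_overshoot l0 ly).
  by rewrite ler_pXn2r ?nnegrE ?ltW.
have hl : l `^ (2 - p) <= L `^ (2 - p) by apply: ler0_powR => //; lra.
have hr : rho `^ (2 - p) <= 1.
  apply: (@le_trans _ _ (1 `^ (2 - p))); last by rewrite powR1.
  by apply: ler0_powR => //; lra.
have h2 : overshoot (rho * l) y' <=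
    2^-1 * overshoot l y + 2 `^ p * w `^ p * L `^ (2 - p).
  apply: le_trans (overshoot_le _ _) _.
  have e1 : y' `^ p <= 2 `^ p * ((a * y) `^ p + w `^ p).
    apply: (@le_trans _ _ ((a * y + w) `^ p)).
      apply: ge0_ler_powR; rewrite ?nnegrE//.
      by rewrite addr_ge0// mulr_ge0//; lra.
    by apply: powRD_le => //; rewrite mulr_ge0//; lra.
  have -> : overshoot l y = y `^ p * l `^ (2 - p) by rewrite /overshoot ly.
  rewrite powRM ?(ltW l0)//.
  apply: (@le_trans _ _ (2 `^ p * ((a * y) `^ p + w `^ p) *
            (rho `^ (2 - p) * l `^ (2 - p)))).
    by apply: ler_wpM2r => //; rewrite mulr_ge0 ?powR_ge0.
  rewrite powRM ?(ltW y0)//; last by lra.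
  rewrite mulrDr mulrDl lerD//.
    rewrite [leLHS](_ : _ = (2 `^ p * a `^ p * rho `^ (2 - p)) *
      (y `^ p * l `^ (2 - p))); last by ring.
    by apply: ler_wpM2r => //; rewrite mulr_ge0 ?powR_ge0.
  apply: ler_wpM2l; first by rewrite mulr_ge0 ?powR_ge0.
  by rewrite -[leRHS]mul1r; apply: ler_pM; rewrite ?powR_ge0.
have h3 : 0 <= L ^+ 2 / K ^+ 2 by rewrite divr_ge0 ?sqr_ge0.
have h4 : 0 <= l ^+ 2 / K ^+ 2 by rewrite divr_ge0 ?sqr_ge0.
rewrite /lyapunov; lra.
Qed.

(** Here [l'] is the next width. The assumptions on it cover both a shrinking width and one that
    already sits at its minimum [L]. The new overshoot can only come from the noise. *)
Lemma lyapunov_inside l l' y w y' : L <= l' -> 0 <= l -> l <= rho * l' ->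
  l' ^+ 2 <= L ^+ 2 + l ^+ 2 / 4 -> 0 <= w -> y' <= a * (l / K) + w ->
  lyapunov l' y' <=
    3 / 4 * lyapunov l y + (L ^+ 2 / K ^+ 2 + 2 `^ p * w `^ p * L `^ (2 - p)).
Proof.
move=> Ll' l0 ll' l'2 w0 y'le.
have := (p2, a1, rho2, L0) => -[[[? ?] ?] ?]; have ? := K0.
have l'0 : 0 < l' by lra.
have h1 : l' ^+ 2 / K ^+ 2 <= L ^+ 2 / K ^+ 2 + 4^-1 * (l ^+ 2 / K ^+ 2).
  have -> : L ^+ 2 / K ^+ 2 + 4^-1 * (l ^+ 2 / K ^+ 2) =
    (L ^+ 2 + l ^+ 2 / 4) / K ^+ 2 by ring.
  by apply: ler_wpM2r => //; rewrite invr_ge0 sqr_ge0.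
have h2 : overshoot l' y' <= 2 `^ p * w `^ p * L `^ (2 - p).
  rewrite /overshoot; case: ifP => [l'y'|_]; last by rewrite !mulr_ge0 ?powR_ge0.
  (* The propagated quantization error fills at most half of the new box, so [l' < y'] forces
     [y' <= 2 * w]. *)
  have half : a * (l / K) <= l' / 2.
    rewrite mulrA ler_pdivrMr//.
    apply: (@le_trans _ _ (a * (rho * l'))).
      by rewrite ler_wpM2l//; lra.
    rewrite [leLHS](_ : _ = l' / 2 * (2 * a * rho)); last by field.
    by rewrite ler_wpM2l//; lra.
  apply: ler_pM; rewrite ?powR_ge0//.
    rewrite -powRM//; apply: ge0_ler_powR; rewrite ?nnegrE; lra.
  by apply: ler0_powR => //; lra.
have h4 : 0 <= l ^+ 2 / K ^+ 2 by rewrite divr_ge0 ?sqr_ge0.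
have h5 := overshoot_ge0 l y.
rewrite /lyapunov; lra.
Qed.

End lyapunov.

Lemma zoom_factor_exists (R : realType) (p a : R) : 2 < p -> 1 <= a ->
  exists2 rho, 2 <= rho & 2 `^ p * a `^ p * rho `^ (2 - p) <= 2^-1.
Proof.
move=> p2 a1; set X := 2 * (2 `^ p * a `^ p).
have X0 : 0 < X by rewrite !mulr_gt0 ?powR_gt0//; lra.
(* The second argument makes the inequality an equality; the maximum with [2] can only lower the
   power with exponent [2 - p < 0]. *)
exists (Num.max 2 (X `^ (p - 2)^-1)); first by rewrite le_max lexx.
apply: (@le_trans _ _ (2 `^ p * a `^ p * (X `^ (p - 2)^-1) `^ (2 - p))).
  rewrite ler_wpM2l ?mulr_ge0 ?powR_ge0//; apply: ler0_powR.
  - lra.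
  - exact: powR_gt0.
  - by rewrite le_max lexx orbT.
rewrite -powRrM (_ : (p - 2)^-1 * (2 - p) = - 1); last by field; lra.
rewrite powR_inv1 ?(ltW X0)// /X invfM mulrCA divff ?mulr1//.
by rewrite mulf_neq0// gt_eqF// powR_gt0//; lra.
Qed.

(** * Vectors and grids *)

Section mx_norm_facts.
Context {R : realType}.

Lemma mx_norm_le m n (x : 'M[R]_(m, n)) r :
  0 <= r -> (forall i j, `|x i j| <= r) -> `|x| <= r.
Proof.
move=> r0 xr; rewrite [leLHS]/Num.norm/= mx_normrE.
by apply: bigmax_le => // -[i j] _; exact: xr.
Qed.

Lemma mx_coord_le m n (x : 'M[R]_(m, n)) i j : `|x i j| <= `|x|.
Proof.
rewrite [leRHS]/Num.norm/= mx_normrE.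
exact: (le_bigmax _ (fun ij : 'I_m * 'I_n => `|x ij.1 ij.2|) (i, j)).
Qed.

Lemma mulmx_bounded n (A : 'M[R]_n) :
  exists2 a, 1 <= a & forall v : 'cV[R]_n, `|A *m v| <= a * `|v|.
Proof.
(* The summand [1] secures [1 <= a], whatever the size of [A]. *)
exists (1 + \sum_i \sum_j `|A i j|).
  by rewrite lerDl; apply: sumr_ge0 => i _; exact: sumr_ge0.
have S0 : 0 <= \sum_i \sum_j `|A i j|.
  by apply: sumr_ge0 => i _; exact: sumr_ge0.
move=> v; apply: mx_norm_le => [|i j].
  by rewrite mulr_ge0//; lra.
rewrite mxE; apply: le_trans (ler_norm_sum _ _ _) _.
apply: (@le_trans _ _ ((\sum_k `|A i k|) * `|v|)).
  rewrite mulr_suml; apply: ler_sum => k _.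
  by rewrite normrM ler_wpM2l// mx_coord_le.
rewrite ler_wpM2r// [X in _ + X](bigD1 i)//=.
have : 0 <= \sum_(k < n | k != i) \sum_j `|A k j|.
  by apply: sumr_ge0 => k _; exact: sumr_ge0.
lra.
Qed.

Lemma quad_form_bounded n (Q : 'M[R]_n) :
  exists2 k, 0 <= k & forall v : 'cV[R]_n, quad_form Q v <= k * `|v| ^+ 2.
Proof.
have [a a1 aQ] := mulmx_bounded Q.
exists (n%:R * a); first by rewrite mulr_ge0//; lra.
move=> v; rewrite /quad_form -mulmxA mxE.
apply: (@le_trans _ _ (\sum_(i < n) (a * `|v| ^+ 2))); last first.
  by rewrite sumr_const card_ord -mulrA mulr_natl.
apply: ler_sum => i _; rewrite mxE.
apply: le_trans (ler_norm _) _; rewrite normrM.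
rewrite expr2 mulrCA; apply: ler_pM => //; first exact: mx_coord_le.
by apply: le_trans (aQ v); exact: mx_coord_le.
Qed.

End mx_norm_facts.

Section grid.
Context {R : realType}.
Variables n K : nat.

(** In each coordinate, these are the midpoints of the [K] equal subintervals of [-1, 1], whose
    half-length is [1 / K]. *)
Definition grid_point (f : {ffun 'I_n -> 'I_K}) : 'cV[R]_n :=
  \col_i ((2 * (f i)%:R + 1) / K%:R - 1).

Lemma grid_cover1 (u : R) : (0 < K)%N -> `|u| <= 1 ->
  exists k : 'I_K, `|u - ((2 * k%:R + 1) / K%:R - 1)| <= K%:R^-1.
Proof.
move=> K0; rewrite ler_norml => /andP[u1 u2].
have KR : 0 < K%:R :> R by rewrite ltr0n.
set s := (u + 1) * K%:R / 2.
have s0 : 0 <= s by rewrite !mulr_ge0//; lra.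
have us : u = 2 * s / K%:R - 1 by rewrite /s; field; rewrite gt_eqF.
suff [k [k1 k2]] : exists k : 'I_K, k%:R <= s /\ s <= k%:R + 1.
  exists k; rewrite us.
  rewrite [X in `|X|](_ : _ = (2 * (s - k%:R) - 1) * K%:R^-1); last by ring.
  rewrite normrM (ger0_norm (_ : 0 <= K%:R^-1)) ?invr_ge0//.
  apply: ler_piMl; first by rewrite invr_ge0.
  by rewrite ler_norml; apply/andP; split; lra.
have [sK|Ks] := ltnP (Num.truncn s) K.
  exists (Ordinal sK) => /=; rewrite truncn_le s0; split => //.
  by have := truncnS_gt s; rewrite -natr1 => /ltW.
(* What remains is the right endpoint [u = 1], where [s = K]; it is assigned to the last cell. *)
have sK : s <= K%:R.
  by rewrite /s ler_pdivrMr// [leRHS]mulrC ler_pM2r//; lra.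
have ltK : (K.-1 < K)%N by rewrite prednK.
exists (Ordinal ltK) => /=.
rewrite truncn_ge_nat// in Ks; rewrite natr1 prednK//; split => //.
by apply: le_trans Ks; rewrite ler_nat leq_pred.
Qed.

Lemma grid_cover (x : 'cV[R]_n) : (0 < K)%N -> `|x| <= 1 ->
  exists f, `|x - grid_point f| <= K%:R^-1.
Proof.
move=> K0 x1.
have /choice[f fP] i : exists k : 'I_K,
    `|x i 0 - ((2 * k%:R + 1) / K%:R - 1)| <= K%:R^-1.
  by apply: grid_cover1 => //; exact: le_trans (mx_coord_le _ _ _) x1.
exists [ffun i => f i]; apply: mx_norm_le => [|i j]; first by rewrite invr_ge0.
by rewrite !mxE ffunE !ord1; exact: fP.
Qed.

End grid.

(** * The zooming quantizer *)

Section quantizer.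
Context {R : realType} {n : nat} {F : finType}.
Variables (c : F -> 'cV[R]_n) (K : R).

(** The test is on the error itself: [Some] then carries the error bound, and [None], the overflow
    symbol, can only occur outside the box once the centres cover it. *)
Definition quantize (l : R) (x : 'cV[R]_n) : option F :=
  [pick f | `|x - l *: c f| <= l / K].

Definition dequantize (l : R) (o : option F) : 'cV[R]_n :=
  if o is Some f then l *: c f else 0.

(** Since [0.-1 = 0], level 0 is kept by a covered state. *)
Definition next_level (j : nat) (o : option F) : nat :=
  if o is Some _ then j.-1 else j.+1.

Lemma quantize_Some l x f : quantize l x = Some f ->
  `|x - dequantize l (quantize l x)| <= l / K.
Proof. by rewrite /quantize; case: pickP. Qed.

Hypothesis c_cover : forall x : 'cV[R]_n, `|x| <= 1 ->
  exists f, `|x - c f| <= K^-1.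

Lemma quantize_None (l : R) x : 0 < l -> quantize l x = None -> l < `|x|.
Proof.
move=> l0; rewrite /quantize; case: pickP => // noF _.
rewrite ltNge; apply/negP => xl.
have [|f fP] := c_cover (x := l^-1 *: x).
  by rewrite normrZ gtr0_norm ?invr_gt0// ler_pdivrMl// mulr1.
have /negbT/negP := noF f; apply.
have -> : x - l *: c f = l *: (l^-1 *: x - c f).
  by rewrite scalerBr scalerA divff ?gt_eqF// scale1r.
by rewrite normrZ gtr0_norm// ler_pM2l.
Qed.

End quantizer.

(** * Measurability of the closed loop *)

Section fiberwise.
Context d (T : measurableType d) (I : countType).

(** Decomposition along the countably many values of [k]. It allows the level or the quantizer
    output to be frozen before measurability is checked. *)
Lemma measurable_fiberwise_set (k : T -> I) (Y : I -> set T) :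
  (forall i, measurable [set x | k x = i]) -> (forall i, measurable (Y i)) ->
  measurable [set x | Y (k x) x].
Proof.
move=> mk mY.
rewrite [X in measurable X](_ : _ = \bigcup_i ([set x | k x = i] `&` Y i)).
  by apply: countable_bigcupT_measurable => // i; exact: measurableI.
apply/seteqP; split => [x /= Yx|x [i _ [/= -> //]]].
by exists (k x).
Qed.

Lemma measurable_fiberwise d' (U : measurableType d') (k : T -> I)
    (f : I -> T -> U) :
  (forall i, measurable [set x | k x = i]) ->
  (forall i, measurable_fun setT (f i)) ->
  measurable_fun setT (fun x => f (k x) x).
Proof.
move=> mk mf _ Y mY; rewrite setTI.
apply: (@measurable_fiberwise_set k (fun i => f i @^-1` Y)) => // i.
by rewrite -[X in measurable X]setTI; exact: mf.
Qed.

End fiberwise.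

(** The picked element depends on [x] only through the truth table of the predicates, and there are
    finitely many such tables. *)
Lemma measurable_pick d (T : measurableType d) (F : finType)
    (p : F -> T -> bool) o :
  (forall f, measurable [set x | p f x]) ->
  measurable [set x | [pick f | p f x] = o].
Proof.
move=> mp.
have -> : [set x | [pick f | p f x] = o] =
    \bigcup_(s in [set s : {ffun F -> bool} | [pick f | s f] = o])
      \bigcap_(f in [set: F]) [set x | p f x = s f].
  apply/seteqP; split => [x /= xo|x [s /= so xs]].
    exists [ffun f => p f x] => /=; last by move=> f _ /=; rewrite ffunE.
    by rewrite -xo; apply: eq_pick => f; rewrite ffunE.
  by rewrite -so; apply: eq_pick => f; exact: xs.
apply: fin_bigcup_measurable => // s _.
apply: fin_bigcap_measurable => // f _.
case: (s f); first exact: mp.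
rewrite [X in measurable X](_ : _ = ~` [set x | p f x]).
  exact/measurableC/mp.
by apply/seteqP; split => x /=; [move=> ->|move/negP/negbTE].
Qed.

Section measurable_matrices.
Context {R : realType}.

Lemma measurable_mx_norm m n :
  measurable_fun setT (fun x : 'M[R]_(m, n) => `|x|).
Proof.
rewrite (_ : (fun x : 'M[R]_(m, n) => `|x|) =
    fun x => \big[Num.max/0]_(ij <- index_enum ('I_m * 'I_n)%type) `|x ij.1 ij.2|).
  elim: index_enum => [|ij s IH].
    by under eq_fun do rewrite big_nil; exact: measurable_cst.
  under eq_fun do rewrite big_cons.
  apply: measurable_maxr => //.
  apply: measurableT_comp => //; exact: measurable_coord.
by apply/funext => x; rewrite [LHS]/Num.norm/= mx_normrE.
Qed.

Context d (T : measurableType d).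

Lemma measurable_addmx m n (f g : T -> 'M[R]_(m, n)) :
  measurable_fun setT f -> measurable_fun setT g ->
  measurable_fun setT (fun x => f x + g x).
Proof.
move=> mf mg; apply: measurable_mxP => i j.
under eq_fun do rewrite mxE.
by apply: measurable_funD; apply: (measurableT_comp (measurable_coord i j)).
Qed.

Lemma measurable_mulmx m n p (A : 'M[R]_(m, n)) (f : T -> 'M[R]_(n, p)) :
  measurable_fun setT f -> measurable_fun setT (fun x => A *m f x).
Proof.
move=> mf; apply: measurable_mxP => i j.
under eq_fun do rewrite mxE.
apply: measurable_sum => k; apply: measurable_funM; first by [].
exact: (measurableT_comp (measurable_coord k j)).
Qed.

End measurable_matrices.

Section measurable_quantizer.
Context {R : realType} {n : nat} {F : finType}.
Variables (c : F -> 'cV[R]_n) (K : R).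

Lemma measurable_quantize d (T : measurableType d) (f : T -> 'cV[R]_n) l o :
  measurable_fun setT f -> measurable [set x | quantize c K l (f x) = o].
Proof.
move=> mf; rewrite /quantize; apply: measurable_pick => e.
have mN : measurable_fun setT (fun x => `|f x - l *: c e|).
  apply: (measurableT_comp (@measurable_mx_norm R n 1)).
  exact: measurable_addmx.
have := mN measurableT `]-oo, l / K]%classic (measurable_itv _).
by rewrite setTI.
Qed.

Definition coding_error (l : R) (x : 'cV[R]_n) : 'cV[R]_n :=
  x - dequantize c l (quantize c K l x).

Lemma measurable_coding_error d (T : measurableType d) (f : T -> 'cV[R]_n) l :
  measurable_fun setT f -> measurable_fun setT (fun x => coding_error l (f x)).
Proof.
move=> mf; rewrite /coding_error; apply: measurable_addmx => //.
apply: (@measurable_fiberwise _ T _ _ _ (fun x => quantize c K l (f x))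
  (fun o _ => - dequantize c l o)) => // o.
exact: measurable_quantize.
Qed.

End measurable_quantizer.

(** * The zooming scheme *)

Section zoom_scheme.
Context {R : realType} {n : nat} {F M : finType}.
Variables (c : F -> 'cV[R]_n) (K L rho : R).
Variables (g : option F -> M) (h : M -> option F).
Hypothesis gK : cancel g h.
Variables (A B : 'M[R]_n).

Definition width (j : nat) : R := L * rho ^+ j.

(* The level depends on the past symbols only, so that encoder and controller
   agree on it. *)
Definition level_of (q : seq M) : nat :=
  foldl (fun j a => next_level j (h a)) 0%N q.

Definition zoom_encoder t (q : t.-tuple M) (x : t.+1.-tuple 'cV[R]_n) : M :=
  g (quantize c K (width (level_of q)) (tnth x ord_max)).

Lemma zoom_encoder_measurable t (q : t.-tuple M) (a : M) :
  measurable [set x : t.+1.-tuple 'cV[R]_n | zoom_encoder q x = a].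
Proof.
apply: (@measurable_fiberwise_set _ _ _
  (fun x : t.+1.-tuple 'cV[R]_n => quantize c K (width (level_of q)) (tnth x ord_max))
  (fun o => [set _ | g o = a])) => o.
  by apply: measurable_quantize; exact: measurable_tnth.
have [->|goa] := eqVneq (g o) a.
  rewrite [X in measurable X](_ : _ = setT)//.
  by apply/seteqP; split.
rewrite [X in measurable X](_ : _ = set0)//.
by apply/seteqP; split => // x /= /eqP; rewrite (negbTE goa).
Qed.

(** The last symbol was produced at the level given by the symbols before it, hence [take t q]. *)
Definition zoom_controller t (q : t.+1.-tuple M) : 'cV[R]_n :=
  - (invmx B *m (A *m dequantize c (width (level_of (take t q)))
                        (h (tnth q ord_max)))).

Definition zoom_scheme : scheme R M n :=
  Scheme zoom_encoder_measurable zoom_controller.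

Section trajectory.
Variables (x0 : 'cV[R]_n) (w : nat -> 'cV[R]_n).

Let x t := state A B zoom_scheme x0 w t.

Definition zoom_level t : nat := level_of (history A B zoom_scheme x0 w t).1.

Definition zoom_error t : 'cV[R]_n :=
  coding_error c K (width (zoom_level t)) (x t).

Lemma zoom_levelS t : zoom_level t.+1 =
  next_level (zoom_level t) (quantize c K (width (zoom_level t)) (x t)).
Proof.
rewrite /zoom_level /x /state/=; case: (history _ _ _ _ _ t) => q y /=.
by rewrite {1}/level_of -cats1 foldl_cat/= gK.
Qed.

Lemma zoom_stateS t : B \in unitmx -> x t.+1 = A *m zoom_error t + w t.
Proof.
move=> Bu; rewrite /x stateS; congr (_ + _).
rewrite /zoom_error /coding_error mulmxBr; congr (_ + _).
rewrite /control /x /zoom_level /state/=; case: (history _ _ _ _ _ t) => q y /=.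
rewrite mulmxN mulKVmx//; congr (- (A *m _)).
rewrite (tnth_nth (g None))/= nth_rcons size_tuple ltnn eqxx.
by rewrite -cats1 take_cat size_tuple ltnn subnn take0 cats0 gK.
Qed.

End trajectory.

(** The sigma-algebra on [T] is arbitrary and only [w t] with [t < N] must be measurable. The lemma
    therefore also applies to the sigma-algebra generated by the initial state and the first [N]
    noises, which is how causality enters the independence argument. *)
Lemma measurable_zoom d (T : measurableType d) (x0 : T -> 'cV[R]_n)
    (w : nat -> T -> 'cV[R]_n) N : B \in unitmx ->
  measurable_fun setT x0 ->
  (forall t, (t < N)%N -> measurable_fun setT (w t)) ->
  forall t, (t <= N)%N ->
    measurable_fun setT (fun z => state A B zoom_scheme (x0 z) (w^~ z) t) /\
    measurable_fun setT (fun z => zoom_error (x0 z) (w^~ z) t).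
Proof.
move=> Bu mx0 mw.
have err t :
    measurable_fun setT (fun z => state A B zoom_scheme (x0 z) (w^~ z) t) ->
    (forall j, measurable [set z | zoom_level (x0 z) (w^~ z) t = j]) ->
    measurable_fun setT (fun z => zoom_error (x0 z) (w^~ z) t).
  move=> mx ml; apply: (@measurable_fiberwise _ T _ _ _
    (fun z => zoom_level (x0 z) (w^~ z) t)
    (fun j z => coding_error c K (width j)
       (state A B zoom_scheme (x0 z) (w^~ z) t))) => // j.
  exact: measurable_coding_error.
(* State and level must be treated in one induction, as each uses both of their predecessors. *)
suff H t : (t <= N)%N ->
    measurable_fun setT (fun z => state A B zoom_scheme (x0 z) (w^~ z) t) /\
    (forall j, measurable [set z | zoom_level (x0 z) (w^~ z) t = j]).
  by move=> t /H[mx ml]; split => //; exact: err.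
elim: t => [_|t IH tN].
  split; first by under eq_fun do rewrite state0.
  move=> j; rewrite /zoom_level/= /level_of/=.
  case: j => [|j].
    by rewrite [X in measurable X](_ : _ = setT)//; apply/seteqP; split.
  by rewrite [X in measurable X](_ : _ = set0)//; apply/seteqP; split.
have [mx ml] := IH (ltnW tN); split.
  under eq_fun do rewrite zoom_stateS//.
  apply: measurable_addmx; last exact: mw.
  exact/measurable_mulmx/err.
move=> j.
rewrite [X in measurable X](_ : _ = [set z |
  [set z' | next_level (zoom_level (x0 z) (w^~ z) t)
     (quantize c K (width (zoom_level (x0 z) (w^~ z) t))
     (state A B zoom_scheme (x0 z') (w^~ z') t)) = j] z]); last first.
  by apply/seteqP; split => z /=; rewrite zoom_levelS.
apply: (@measurable_fiberwise_set _ _ _ (fun z => zoom_level (x0 z) (w^~ z) t)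
  (fun i => [set z' | next_level i
     (quantize c K (width i)
     (state A B zoom_scheme (x0 z') (w^~ z') t)) = j])) => // i.
apply: (@measurable_fiberwise_set _ _ _
  (fun z => quantize c K (width i) (state A B zoom_scheme (x0 z) (w^~ z) t))
  (fun o => [set _ | next_level i o = j])) => o.
  exact: measurable_quantize.
have [->|goa] := eqVneq (next_level i o) j.
  by rewrite [X in measurable X](_ : _ = setT)//; apply/seteqP; split.
rewrite [X in measurable X](_ : _ = set0)//.
by apply/seteqP; split => // z /= /eqP; rewrite (negbTE goa).
Qed.

End zoom_scheme.

(** * The Lyapunov bound along a trajectory *)

Section zoom_path.
Context {R : realType} {n : nat} {F M : finType}.
Variables (c : F -> 'cV[R]_n) (p a K L rho : R).
Variables (g : option F -> M) (h : M -> option F) (A B : 'M[R]_n).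
Hypotheses (gK : cancel g h) (Bu : B \in unitmx).
Hypothesis Aa : forall v : 'cV[R]_n, `|A *m v| <= a * `|v|.
Hypotheses (p2 : 2 < p) (a1 : 1 <= a) (rho2 : 2 <= rho) (L0 : 0 < L).
Hypothesis rhop : 2 `^ p * a `^ p * rho `^ (2 - p) <= 2^-1.
Hypothesis Krho : 2 * a * rho <= K.
Hypothesis c_cover : forall x : 'cV[R]_n, `|x| <= 1 ->
  exists f, `|x - c f| <= K^-1.

Variables (x0 : 'cV[R]_n) (w : nat -> 'cV[R]_n).

Let S := zoom_scheme c K L rho g h A B.
Let x t := state A B S x0 w t.
Let l t := width L rho (zoom_level c K L rho g h A B x0 w t).
Let e t := zoom_error c K L rho g h A B x0 w t.
Let V t := lyapunov p K (l t) `|x t|.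

Let rho_ge1 : 1 <= rho. Proof. have := rho2; lra. Qed.

Let width_ge j : L <= width L rho j.
Proof. by rewrite /width ler_peMr ?exprn_ege1// ltW. Qed.

Let width_gt0 j : 0 < width L rho j.
Proof. exact: lt_le_trans (width_ge j). Qed.

Let widthS j : width L rho j.+1 = rho * width L rho j.
Proof. by rewrite /width exprS mulrCA. Qed.

Let sqr_error_le t : `|e t| ^+ 2 <= V t.
Proof.
rewrite /e /zoom_error /coding_error -/S -/(x t) -/(l t).
case q : (quantize c K (l t) (x t)) => [f|].
  apply: le_trans (lyapunov_ge_width _ _ _ _).
  have := quantize_Some q; rewrite q => ele.
  by rewrite -expr_div_n ler_pXn2r ?nnegrE//; exact: le_trans ele.
rewrite /= subr0; apply: sqr_le_lyapunov => //; first exact: width_gt0.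
exact: (quantize_None c_cover (width_gt0 _) q).
Qed.

Let lyapunov_step t : V t.+1 <=
  3 / 4 * V t + (L ^+ 2 / K ^+ 2 + 2 `^ p * `|w t| `^ p * L `^ (2 - p)).
Proof.
have xS : `|x t.+1| <= a * `|e t| + `|w t|.
  rewrite /x zoom_stateS//; apply: le_trans (ler_normD _ _) _.
  by rewrite lerD2r.
rewrite /V {1}/l zoom_levelS// -/S -/(x t) -/(l t).
move: xS; rewrite /e /zoom_error /coding_error -/S -/(x t) -/(l t).
case q : (quantize c K (l t) (x t)) => [f|] /= xS.
  have xle : `|x t.+1| <= a * (l t / K) + `|w t|.
    apply: (le_trans xS); rewrite lerD2r ler_wpM2l//; first by have := a1; lra.
    by have := quantize_Some q; rewrite q.
  (* At level 0 the width stays at [L], and [L ^+ 2] alone dominates the new square; at a positive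
     level the width is divided by [rho >= 2], so its square drops by a factor of at least 4. *)
  apply: (lyapunov_inside p2 a1 rho2 L0 Krho) => //; first exact: (ltW (width_gt0 _)).
    rewrite /l; case: zoom_level => [|j]/=; last by rewrite widthS.
    by rewrite ler_peMl// ltW.
  rewrite /l; case: zoom_level => [|j]/=.
    rewrite {1}/width expr0 mulr1 lerDl.
    by rewrite divr_ge0// sqr_ge0.
  rewrite widthS; move: (width L rho j) => u.
  have rho4 : 4 * u ^+ 2 <= rho ^+ 2 * u ^+ 2.
    by rewrite ler_wpM2r ?sqr_ge0//; have := rho2; nra.
  have := sqr_ge0 L; rewrite [X in X / 4]exprMn; move: rho4.
  move: (u ^+ 2) (rho ^+ 2) (L ^+ 2) => *; lra.
have Ll : L <= l t := width_ge _.
have lx : l t < `|x t| := quantize_None c_cover (width_gt0 _) q.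
rewrite widthS -/(l t); apply: (lyapunov_overflow p2 a1 rho2 L0 rhop Krho) => //.
by move: xS; rewrite subr0.
Qed.

(** The bound is pathwise and its right side involves only the initial state and the noise. It thus
    yields the integrability of the errors as well as the size of their mean. *)
Lemma sum_sqr_error_le N :
  \sum_(0 <= t < N) `|e t| ^+ 2 <=
  4 * (L ^+ 2 / K ^+ 2 + `|x0| `^ p * L `^ (2 - p) +
    \sum_(0 <= t < N)
      (L ^+ 2 / K ^+ 2 + 2 `^ p * `|w t| `^ p * L `^ (2 - p))).
Proof.
apply: (@le_trans _ _ (\sum_(0 <= t < N) V t)).
  by apply: ler_sum => t _; exact: sqr_error_le.
apply: le_trans (sum_contraction_le N _ lyapunov_step) _.
  by move=> t; exact: lyapunov_ge0.
rewrite ler_pM2l// lerD2r /V /l /x state0.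
have -> : zoom_level c K L rho g h A B x0 w 0 = 0%N by [].
rewrite /width expr0 mulr1 /lyapunov lerD2l.
exact: overshoot_le.
Qed.

End zoom_path.

(** * Means and independence *)

Section has_mean.
Context {d} {T : measurableType d} {R : realType} (P : probability T R).
Implicit Types (f g : T -> R) (m : R).

(** Integrability is bundled with a real value, so that linearity and monotonicity hold without side
    conditions in extended reals. *)
Definition has_mean f m : Prop :=
  P.-integrable setT (EFin \o f) /\ 'E_P[f]%E = m%:E.

Lemma has_mean_cst r : has_mean (cst r) r.
Proof.
split; first exact: finite_measure_integrable_cst.
by rewrite expectation_cst.
Qed.

Lemma has_meanD f g m m' : has_mean f m -> has_mean g m' ->
  has_mean (fun x => f x + g x) (m + m').
Proof.
move=> [If Ef] [Ig Eg]; split.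
  by have := integrableD measurableT If Ig; apply: eq_integrable.
move: Ef Eg; rewrite !unlock => Ef Eg.
by rewrite integralD_EFin// Ef Eg EFinD.
Qed.

Lemma has_meanZ r f m : has_mean f m -> has_mean (fun x => r * f x) (r * m).
Proof.
move=> [If Ef]; split.
  by have := integrableZl measurableT r If; apply: eq_integrable.
move: Ef; rewrite !unlock => Ef.
by under eq_integral do rewrite EFinM; rewrite integralZl// Ef EFinM.
Qed.

Lemma eq_has_mean f g m : f =1 g -> has_mean f m -> has_mean g m.
Proof. by move=> /funext ->. Qed.

Lemma has_mean_sum (I : Type) (s : seq I) (f : I -> T -> R) (m : I -> R) :
  (forall i, has_mean (f i) (m i)) ->
  has_mean (fun x => \sum_(i <- s) f i x) (\sum_(i <- s) m i).
Proof.
move=> fm; elim: s => [|i s IH].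
  rewrite big_nil; apply: (eq_has_mean _ (has_mean_cst 0)) => x.
  by rewrite big_nil.
rewrite big_cons; apply: (eq_has_mean _ (has_meanD (fm i) IH)) => x.
by rewrite big_cons.
Qed.

Lemma has_mean_le f g m m' : has_mean f m -> has_mean g m' ->
  (forall x, f x <= g x) -> m <= m'.
Proof.
move=> [If Ef] [Ig Eg] fg; rewrite -lee_fin -Ef -Eg !unlock.
by apply: le_integral => // x _; rewrite lee_fin.
Qed.

Lemma has_mean_ge0 f m : has_mean f m -> (forall x, 0 <= f x) -> 0 <= m.
Proof. by move=> fm f0; apply: has_mean_le (has_mean_cst 0) fm _. Qed.

Lemma integrable_has_mean f : P.-integrable setT (EFin \o f) ->
  exists m, has_mean f m.
Proof.
move=> If; exists (fine 'E_P[f]%E); split => //.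
by rewrite fineK// unlock; exact: integrable_fin_num.
Qed.

Lemma dominated_has_mean f g m : measurable_fun setT f -> has_mean g m ->
  (forall x, `|f x| <= g x) -> exists m', has_mean f m'.
Proof.
move=> mf [Ig _] fg; apply: integrable_has_mean.
apply: le_integrable Ig => //; first exact/measurable_EFinP.
move=> x _ /=; rewrite lee_fin; apply: le_trans (fg x) _; exact: ler_norm.
Qed.

Lemma ge0_has_mean f : measurable_fun setT f -> (forall x, 0 <= f x) ->
  ('E_P[f] < +oo)%E -> exists m, has_mean f m.
Proof.
move=> mf f0; rewrite unlock => foo; apply: integrable_has_mean.
apply/integrableP; split; first exact/measurable_EFinP.
by under eq_integral do rewrite /= ger0_norm//.
Qed.

(** Both means are integrals of [f] against the common law. Nonnegative functions come first, to
    carry integrability from [X] to [Y]. *)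
Lemma identically_distributed_has_mean d' (U : measurableType d')
    (X Y : T -> U) (f : U -> R) m :
  measurable_fun setT X -> measurable_fun setT Y -> measurable_fun setT f ->
  (forall A, measurable A -> P (X @^-1` A) = P (Y @^-1` A)) ->
  has_mean (f \o X) m -> has_mean (f \o Y) m.
Proof.
move=> mX mY mf XY [IX EX].
have fX : measurable_fun setT (EFin \o f \o X).
  exact/measurable_EFinP/measurableT_comp.
have mEf : measurable_fun setT (EFin \o f) by exact/measurable_EFinP.
have XYI (k : U -> \bar R) : measurable_fun setT k -> (forall u, 0 <= k u)%E ->
    (\int[P]_x k (X x) = \int[P]_x k (Y x))%E.
  move=> mk k0.
  have E (Z : T -> U) : measurable_fun setT Z ->
      (\int[P]_x k (Z x) = \int[pushforward P Z]_u k u)%E.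
    by move=> mZ; rewrite ge0_integral_pushforward// preimage_setT.
  rewrite !E//.
  by apply: eq_measure_integral => A mA _; exact: XY.
have IY : P.-integrable setT (EFin \o (f \o Y)).
  apply/integrableP; split; first exact/measurable_EFinP/measurableT_comp.
  move/integrableP : IX => [_]; congr (_ < _)%E.
  apply: (XYI (fun u => `|f u|%:E)) => //.
  exact/measurable_EFinP/measurableT_comp.
split => //; move: EX; rewrite unlock => <-.
have := integral_pushforward mX (D := setT) (f := EFin \o f) (mu := P)
  mEf IX measurableT.
have := integral_pushforward mY (D := setT) (f := EFin \o f) (mu := P)
  mEf IY measurableT.
rewrite !preimage_setT => <- <-.
by apply: eq_measure_integral => A mA _; apply/esym/XY.
Qed.

(** The joint law of [f] and [g] is the product of their laws, and the product function is
    integrable, so Fubini applies: for each value of [f], the inner integral is that value times the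
    mean of [g], hence 0. *)
Lemma mean_mul_independent f g :
  measurable_fun setT f -> measurable_fun setT g ->
  (forall A B, measurable A -> measurable B ->
     P (f @^-1` A `&` g @^-1` B) = (P (f @^-1` A) * P (g @^-1` B))%E) ->
  P.-integrable setT (EFin \o (fun x => f x * g x)) ->
  has_mean g 0 -> has_mean (fun x => f x * g x) 0.
Proof.
move=> mf mg ind Ifg [Ig Eg]; split => //.
pose f' : {RV P >-> R} := HB.pack f (isMeasurableFun.Build _ _ _ _ f mf).
pose g' : {RV P >-> R} := HB.pack g (isMeasurableFun.Build _ _ _ _ g mg).
pose phi x := (f x, g x).
have mphi : measurable_fun setT phi by exact: measurable_fun_pair.
pose k (z : R * R) := (z.1 * z.2)%:E.
have mk : measurable_fun setT k.
  apply/measurable_EFinP; apply: measurable_funM;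
    [exact: measurable_fst|exact: measurable_snd].
have prodE X : measurable X ->
    (distribution P f' \x distribution P g')%E X = pushforward P phi X.
  by move: X; apply: (product_measure_unique (m' := pushforward P phi)).
have Ik : (pushforward P phi).-integrable setT k.
  by apply: integrable_pushforward.
have := integral_pushforward mphi (D := setT) (f := k) (mu := P)
  mk Ifg measurableT.
rewrite preimage_setT unlock => <-.
transitivity (\int[(distribution P f' \x distribution P g')%E]_z k z)%E.
  by apply/esym/eq_measure_integral => X mX _; exact: prodE.
rewrite -integral12_prod_meas1; last first.
  apply/integrableP; split => //; case/integrableP : Ik => _.
  apply: le_lt_trans; rewrite le_eqVlt; apply/orP; left; apply/eqP.
  by apply: eq_measure_integral => X mX _; exact: prodE.
have mid : measurable_fun setT (EFin : R -> \bar R) by exact/measurable_EFinP.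
have Iid : (distribution P g').-integrable setT (EFin : R -> \bar R).
  by apply: (integrable_pushforward mg mid) => //; rewrite preimage_setT.
have Eid : (\int[distribution P g']_y y%:E = 0)%E.
  by move: Eg; rewrite unlock integral_distribution.
rewrite /fubini_F integral0_eq// => x _.
under eq_integral do rewrite /k/= EFinM.
by rewrite integralZl// Eid mule0.
Qed.

End has_mean.

(** * Independence of the current noise from the past *)

Section past.
Context {d d'} {T : measurableType d} {U : measurableType d'} {R : realType}.
Variables (P : probability T R) (x0 : {RV P >-> U}) (w : nat -> {RV P >-> U}).

(* A pi-system generating the sigma-algebra of x0, w_0, ..., w_(t-1). *)
Definition past t : set_system T := [set E | exists A0 (A : nat -> set U),
  [/\ measurable A0, forall s, measurable (A s) &
      E = x0 @^-1` A0 `&` \bigcap_(s in [set` iota 0 t]) w s @^-1` A s]].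

Let meas_pre (X : {RV P >-> U}) A : measurable A -> measurable (X @^-1` A).
Proof. by move=> mA; rewrite -[X in measurable X]setTI; exact: measurable_funP. Qed.

Lemma past_measurable t : past t `<=` measurable.
Proof.
move=> _ [A0 [A [mA0 mA ->]]]; apply: measurableI; first exact: meas_pre.
by apply: fin_bigcap_measurable => // s _; exact: meas_pre.
Qed.

Lemma past_setI t : setI_closed (past t).
Proof.
move=> _ _ [A0 [A [mA0 mA ->]]] [B0 [B [mB0 mB ->]]].
exists (A0 `&` B0), (fun s => A s `&` B s); split; first exact: measurableI.
  by move=> s; exact: measurableI.
under [in RHS]eq_bigcapr do rewrite preimage_setI.
by rewrite preimage_setI bigcapI setIACA.
Qed.

Lemma pastT t : past t setT.
Proof.
exists setT, (fun=> setT); split => //.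
rewrite preimage_setT setTI; apply/esym; rewrite -subTset => z _ s _.
by [].
Qed.

Lemma past_x0 t A : measurable A -> past t (x0 @^-1` A).
Proof.
move=> mA; exists A, (fun=> setT); split => //.
rewrite [X in _ `&` X](_ : _ = setT) ?setIT//.
by rewrite -subTset => z _ s _.
Qed.

Lemma past_w t s A : (s < t)%N -> measurable A -> past t (w s @^-1` A).
Proof.
move=> st mA; exists setT, (fun i => if i == s then A else setT); split => //.
  by move=> i; case: ifP.
rewrite preimage_setT setTI; apply/seteqP; split => z /=.
  by move=> Az i _ /=; case: eqP => // ->.
by move=> /(_ s); rewrite /= mem_iota/= add0n eqxx; exact.
Qed.

Hypotheses (w_indep : mutually_independent w)
  (x0_indep : independent_of_family x0 w).

(** First [x0_indep] separates the initial state from the whole noise, then [w_indep] factors the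
    noise events. The family [C] inserts [B] at index [t], which does not occur in [iota 0 t]. *)
Let past_indep0 t E B : past t E -> measurable B ->
  P (E `&` w t @^-1` B) = (P E * P (w t @^-1` B))%E.
Proof.
move=> [A0 [A [mA0 mA ->]]] mB.
have fam (s : seq nat) (C : nat -> set U) : (forall i, measurable (C i)) ->
    sigma_family w (\bigcap_(i in [set` s]) w i @^-1` C i).
  move=> mC.
  apply: (@fin_bigcap_measurable _ (g_sigma_algebraType
    (\bigcup_(i in [set: nat]) preimage_set_system setT (w i) measurable))) => //.
  move=> i _; apply: sub_sigma_algebra; exists i => //.
  by exists (C i) => //; rewrite setTI.
have indep (s : seq nat) C : (forall i, measurable (C i)) -> uniq s ->
    P (x0 @^-1` A0 `&` \bigcap_(i in [set` s]) w i @^-1` C i) =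
    (P (x0 @^-1` A0) * \prod_(i <- s) P (w i @^-1` C i))%E.
  by move=> mC us; rewrite x0_indep//; [rewrite w_indep|exact: fam].
pose C i := if i == t then B else A i.
have mC i : measurable (C i) by rewrite /C; case: ifP.
have CA i : i \in iota 0 t -> C i = A i.
  by rewrite mem_iota /C add0n => /andP[_ it]; rewrite ltn_eqF.
rewrite -setIA [X in P (_ `&` X)](_ : _ =
    \bigcap_(i in [set` rcons (iota 0 t) t]) w i @^-1` C i); last first.
  apply/seteqP; split => z /=.
    move=> [zA zB] i /=; rewrite mem_rcons inE => /predU1P[->|it].
      by rewrite /C eqxx.
    by rewrite CA//; exact: zA.
  move=> zC; split.
    move=> i /= it; rewrite -CA//; apply: zC => /=.
    by rewrite mem_rcons inE it orbT.
  by have := zC t; rewrite /= mem_rcons inE eqxx /C eqxx; exact.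
rewrite !indep ?iota_uniq//; last first.
  by rewrite rcons_uniq iota_uniq mem_iota add0n ltnn.
rewrite -cats1 big_cat big_seq1/= {2}/C eqxx muleA; congr (_ * _ * _)%E.
by rewrite [LHS]big_seq [RHS]big_seq; apply: eq_bigr => i /CA ->.
Qed.

(** As functions of [E], both sides are finite measures that agree on the pi-system [past t], hence
    on the sigma-algebra it generates. *)
Lemma past_independent t E B : <<s past t >> E -> measurable B ->
  P (E `&` w t @^-1` B) = (P E * P (w t @^-1` B))%E.
Proof.
move=> sE mB.
have mD : measurable (w t @^-1` B) by exact: meas_pre.
have D0 : 0 <= fine (P (w t @^-1` B)) by exact: fine_ge0.
pose m2 : {measure set T -> \bar R} := mscale (NngNum D0) P.
have -> : (P E * P (w t @^-1` B) = m2 E)%E.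
  by rewrite /m2/= /mscale/= fineK ?fin_num_measure// muleC.
apply: (@g_sigma_algebra_measure_unique _ _ _ (past t) (@past_measurable t)
  (fun=> setT) _ _ (mrestr P mD) m2) => //.
- by move=> _; exact: pastT.
- by rewrite bigcup_const.
- exact: past_setI.
- move=> A pA; rewrite /m2/= /mscale/= fineK ?fin_num_measure// muleC.
  exact: past_indep0.
- by move=> k; rewrite ltey_eq fin_num_measure.
Qed.

Lemma measurable_past_x0 t :
  measurable_fun [set: g_sigma_algebraType (past t)] x0.
Proof.
by move=> _ A mA; rewrite setTI; apply: sub_sigma_algebra; exact: past_x0.
Qed.

Lemma measurable_past_w t s : (s < t)%N ->
  measurable_fun [set: g_sigma_algebraType (past t)] (w s).
Proof.
by move=> st _ A mA; rewrite setTI; apply: sub_sigma_algebra; exact: past_w.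
Qed.

Lemma past_measurable_independent t (f : T -> R) (B : set U) (A : set R) :
  measurable_fun [set: g_sigma_algebraType (past t)] f ->
  measurable A -> measurable B ->
  P (f @^-1` A `&` w t @^-1` B) = (P (f @^-1` A) * P (w t @^-1` B))%E.
Proof.
move=> mf mA; apply: past_independent.
by have := mf measurableT A mA; rewrite setTI.
Qed.

Lemma past_measurable_fun d1 (V : measurableType d1) t (f : T -> V) :
  measurable_fun [set: g_sigma_algebraType (past t)] f ->
  measurable_fun [set: T] f.
Proof.
move=> mf _ A mA; have := mf measurableT A mA.
exact: (smallest_sub (@sigma_algebra_measurable _ T) (@past_measurable t)).
Qed.

End past.

(** * Long-run averages *)

(** Index 0 is excluded because an average over an empty horizon, with [0^-1 = 0], need not obey the
    bounds. *)
Lemma le_limn_esup (R : realType) (u v : (\bar R)^nat) :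
  (forall n, (0 < n)%N -> (u n <= v n)%E) -> (limn_esup u <= limn_esup v)%E.
Proof.
move=> uv; rewrite !limn_esup_lim; apply: lee_lim.
- exact: is_cvg_esups.
- exact: is_cvg_esups.
near=> m; apply: ge_ereal_sup => _ [k /= mk <-].
apply: le_trans (uv k _) _; last by apply: ereal_sup_ubound; exists k.
by apply: leq_trans mk; near: m; exact: nbhs_infty_gt.
Unshelve. all: by end_near. Qed.

Lemma limn_esup_affine (R : realType) (l k : R) :
  limn_esup (fun n => (l + k * n%:R^-1)%:E) = l%:E.
Proof.
apply: (cvg_limn_einf_sup _).2; apply: cvg_EFin; first exact: nearW.
rewrite -[X in _ --> X]addr0; apply: cvgD; first exact: cvg_cst.
rewrite -[X in _ --> X](mulr0 k); apply: cvgM; first exact: cvg_cst.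
rewrite -(@cvg_shiftS _ (fun n : nat => n%:R^-1 : R)).
exact: cvg_harmonic.
Qed.

(** This dominates the first and second moments by the [p]-th one. *)
Lemma powR_ge_le1D (R : realType) (r p y : R) : 0 <= y -> 0 < r -> r <= p ->
  y `^ r <= 1 + y `^ p.
Proof.
move=> y0 r0 rp; have [y1|/ltW y1] := lerP 1 y.
  by apply: ler_wpDl => //; exact: ler_powR.
apply: (@le_trans _ _ 1); last by rewrite lerDl powR_ge0.
have <- : 1 `^ r = 1 :> R by rewrite powR1.
apply: ge0_ler_powR => //; exact: ltW.
Qed.

Lemma bilinear_sum (R : comRingType) n (Q : 'M[R]_n) (u v : 'cV[R]_n) :
  (u^T *m Q *m v) 0 0 = \sum_i \sum_j Q i j * (u i 0 * v j 0).
Proof.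
rewrite -mulmxA mxE; apply: eq_bigr => i _; rewrite !mxE mulr_sumr.
by apply: eq_bigr => j _; rewrite mulrCA.
Qed.

Lemma quad_formD (R : realType) n (Q : 'M[R]_n) (u v : 'cV[R]_n) :
  quad_form Q (u + v) = quad_form Q u + quad_form Q v +
    ((u^T *m Q *m v) 0 0 + (v^T *m Q *m u) 0 0).
Proof.
have uvT : (u + v)^T = u^T + v^T by apply/matrixP => i j; rewrite !mxE.
rewrite /quad_form uvT.
rewrite -!mulmxA !mulmxDl !mulmxDr.
rewrite !mxE; ring.
Qed.

(** * Expected cost of the zooming scheme *)

Section zoom_cost.
Context {d} {T : measurableType d} {R : realType} (P : probability T R).
Context {n : nat} {F M : finType}.
Variables (A B Q Sigma : 'M[R]_n) (x0 : {RV P >-> 'cV[R]_n})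
  (w : nat -> {RV P >-> 'cV[R]_n}).
Variables (c : F -> 'cV[R]_n) (p a K L rho k mu0 mu : R).
Variables (g : option F -> M) (h : M -> option F).
Hypotheses (gK : cancel g h) (Bu : B \in unitmx).
Hypothesis Aa : forall v : 'cV[R]_n, `|A *m v| <= a * `|v|.
Hypotheses (p2 : 2 < p) (a1 : 1 <= a) (rho2 : 2 <= rho) (L0 : 0 < L).
Hypothesis rhop : 2 `^ p * a `^ p * rho `^ (2 - p) <= 2^-1.
Hypothesis Krho : 2 * a * rho <= K.
Hypothesis c_cover : forall x : 'cV[R]_n, `|x| <= 1 ->
  exists f, `|x - c f| <= K^-1.
Hypotheses (Q0 : forall v, 0 <= quad_form Q v).
Hypotheses (k0 : 0 <= k) (Qk : forall v, quad_form Q v <= k * `|v| ^+ 2).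
Hypotheses (w_iid : iid w) (w_mean : zero_mean (w 0%N))
  (w_cov : has_covariance (w 0%N) Sigma)
  (x0_indep : independent_of_family x0 w).
Hypotheses (w_mu : has_mean P (fun z => `|w 0%N z| `^ p) mu)
  (x0_mu : has_mean P (fun z => `|x0 z| `^ p) mu0).

Let S := zoom_scheme c K L rho g h A B.
Let x t z := state A B S (x0 z) (w^~ z) t.
Let e t z := zoom_error c K L rho g h A B (x0 z) (w^~ z) t.

Let mRV (X : {RV P >-> 'cV[R]_n}) : measurable_fun setT X.
Proof. exact: measurable_funP. Qed.

Let mcoord d' (T' : measurableType d') (f : T' -> 'cV[R]_n) i :
  measurable_fun setT f -> measurable_fun setT (fun z => f z i 0).
Proof. exact: (measurableT_comp (measurable_coord i 0)). Qed.

Let mnorm d' (T' : measurableType d') (f : T' -> 'cV[R]_n) :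
  measurable_fun setT f -> measurable_fun setT (fun z => `|f z|).
Proof. exact: (measurableT_comp (@measurable_mx_norm R n 1)). Qed.

Let mw_past t s : (s < t)%N ->
  measurable_fun [set: g_sigma_algebraType (past x0 w t)] (w s).
Proof. exact: measurable_past_w. Qed.

(** The error at time [t] is a function of the initial state and of the noises before [t] only. *)
Let me t : measurable_fun [set: g_sigma_algebraType (past x0 w t)] (e t).
Proof.
have [_] := measurable_zoom c K L rho gK A Bu (@measurable_past_x0 _ _ _ _ _ P x0 w t)
  (@mw_past t) (leqnn t).
exact.
Qed.

Let meT t : measurable_fun setT (e t).
Proof. exact: (past_measurable_fun (@me t)). Qed.

Let mx t : measurable_fun setT (x t).
Proof.
have [] := measurable_zoom c K L rho gK A Bu (@mRV x0)
  (fun s (_ : (s < t)%N) => @mRV (w s)) (leqnn t).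
by [].
Qed.

Let same_law t (f : 'cV[R]_n -> R) m : measurable_fun setT f ->
  has_mean P (f \o w 0%N) m -> has_mean P (f \o w t) m.
Proof.
move=> mf; apply: identically_distributed_has_mean => // A' mA.
by rewrite -(w_iid.2 t).
Qed.

Let w_pow t : has_mean P (fun z => `|w t z| `^ p) mu.
Proof.
apply: (@same_law t (fun v => `|v| `^ p)) => //.
exact: (measurableT_comp (measurable_powR p) (@measurable_mx_norm R n 1)).
Qed.

Let w_sqr_dom t z : `|w t z| ^+ 2 <= 1 + `|w t z| `^ p.
Proof. by rewrite -powR_mulrn//; apply: powR_ge_le1D => //; exact: ltW. Qed.

Let w_coord t i : has_mean P (fun z => w t z i 0) 0.
Proof.
apply: (@same_law t (fun v => v i 0)); first exact: measurable_coord.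
split; last exact: w_mean.
have [m [Im _]] : exists m, has_mean P (fun z => w 0%N z i 0) m.
  apply: (dominated_has_mean (mcoord i (@mRV _))
    (has_meanD (has_mean_cst P 1) w_mu)) => z.
  apply: le_trans (mx_coord_le _ _ _) _.
  rewrite -[leLHS]powRr1//; apply: powR_ge_le1D => //; have := p2; lra.
exact: Im.
Qed.

Let w_prod t i j : has_mean P (fun z => w t z i 0 * w t z j 0) (Sigma i j).
Proof.
have mf : measurable_fun setT (fun v : 'cV[R]_n => v i 0 * v j 0).
  by apply: measurable_funM; exact: measurable_coord.
apply: (@same_law t (fun v => v i 0 * v j 0)) => //.
have [m hm] : exists m, has_mean P (fun z => w 0%N z i 0 * w 0%N z j 0) m.
  apply: (dominated_has_mean (measurableT_comp mf (@mRV _))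
    (has_meanD (has_mean_cst P 1) w_mu)) => z.
  apply: le_trans (w_sqr_dom 0 z); rewrite normrM expr2.
  by apply: ler_pM => //; exact: mx_coord_le.
split; first exact: hm.1.
rewrite -(w_cov i j); congr ('E_P[_])%E; apply/funext => z.
by rewrite mxE big_ord1 mxE.
Qed.

Let w_quad t : has_mean P (fun z => quad_form Q (w t z)) (\tr (Q *m Sigma)).
Proof.
have -> : \tr (Q *m Sigma) = \sum_i \sum_j Q i j * Sigma j i.
  by rewrite /mxtrace; apply: eq_bigr => i _; rewrite mxE.
apply: (eq_has_mean (f := fun z =>
    \sum_i \sum_j Q i j * (w t z j 0 * w t z i 0))).
  move=> z; rewrite /quad_form bilinear_sum.
  by apply: eq_bigr => i _; apply: eq_bigr => j _; rewrite mulrCA mulrC mulrA.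
apply: has_mean_sum => i; apply: has_mean_sum => j; exact: has_meanZ.
Qed.

(** This is the mean of the forcing term in one Lyapunov step. *)
Let gap : R := L ^+ 2 / K ^+ 2 + 2 `^ p * mu * L `^ (2 - p).

Let error_bound N z := 4 * (L ^+ 2 / K ^+ 2 + `|x0 z| `^ p * L `^ (2 - p) +
    \sum_(0 <= t < N)
      (L ^+ 2 / K ^+ 2 + 2 `^ p * `|w t z| `^ p * L `^ (2 - p))).

Let error_bound_mean N : has_mean P (error_bound N)
  (4 * (L ^+ 2 / K ^+ 2 + mu0 * L `^ (2 - p) + N%:R * gap)).
Proof.
apply: has_meanZ; apply: has_meanD.
  apply: has_meanD; first exact: has_mean_cst.
  rewrite mulrC; apply: eq_has_mean (has_meanZ _ x0_mu) => z.
  by rewrite mulrC.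
have -> : N%:R * gap = \sum_(0 <= t < N) gap.
  by rewrite sumr_const_nat subn0 mulr_natl.
apply: has_mean_sum => t; apply: has_meanD; first exact: has_mean_cst.
rewrite mulrAC; apply: eq_has_mean (has_meanZ _ (w_pow t)) => z.
by rewrite mulrAC.
Qed.

Let sum_error_le N z : \sum_(0 <= t < N) `|e t z| ^+ 2 <= error_bound N z.
Proof. exact: sum_sqr_error_le. Qed.

Let e_sqr t : exists m, has_mean P (fun z => `|e t z| ^+ 2) m.
Proof.
(* One squared error is at most the sum of all those up to and including time [t]. *)
apply: (dominated_has_mean _ (error_bound_mean t.+1)) => [|z].
  by apply: measurable_funX; exact: mnorm.
apply: le_trans (sum_error_le _ z); rewrite big_nat_recr//=.
rewrite ger0_norm ?sqr_ge0//.
by rewrite lerDr; apply: sumr_ge0 => s _; exact: sqr_ge0.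
Qed.

Let Ae_le t z : `|A *m e t z| ^+ 2 <= a ^+ 2 * `|e t z| ^+ 2.
Proof.
rewrite -exprMn ler_pXn2r ?nnegrE// mulr_ge0//; have := a1; lra.
Qed.

(** The first factor depends on the past, the second is independent of it and centred. The product
    is integrable since [u * v <= u ^+ 2 + v ^+ 2] for nonnegative [u] and [v]. *)
Let cross t i j : has_mean P (fun z => (A *m e t z) i 0 * w t z j 0) 0.
Proof.
have mAe : measurable_fun [set: g_sigma_algebraType (past x0 w t)]
    (fun z => (A *m e t z) i 0).
  apply: (@mcoord _ (g_sigma_algebraType (past x0 w t)) (fun z => A *m e t z)).
  by apply: measurable_mulmx; exact: me.
have mAeT := past_measurable_fun mAe.
have mwj : measurable_fun setT (fun z => w t z j 0) 
  by apply: (@mcoord _ _ (w t)); exact: mRV.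
have [m em] := e_sqr t.
have aem := has_meanZ (a ^+ 2) em.
apply: (mean_mul_independent mAeT mwj _ _ (w_coord t j)).
  move=> C D mC mD.
  have mD' : measurable ((fun v : 'cV[R]_n => v j 0) @^-1` D).
    by have := measurable_coord (m := n) (n := 1) (R := R) j 0 measurableT mD; rewrite setTI.
  exact: (past_measurable_independent w_iid.1 x0_indep mAe mC mD').
have [m' [Im' _]] : exists m',
    has_mean P (fun z => (A *m e t z) i 0 * w t z j 0) m'.
  apply: (dominated_has_mean _
    (has_meanD aem (has_meanD (has_mean_cst P 1) (w_pow t)))) => [|z].
    exact: measurable_funM.
  rewrite normrM; have := Ae_le t z; have := w_sqr_dom t z.
  have := mx_coord_le (A *m e t z) i 0; have := mx_coord_le (w t z) j 0.
  have := normr_ge0 ((A *m e t z) i 0); have := normr_ge0 (w t z j 0).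
  move: `|(A *m e t z) i 0| `|w t z j 0| => u v v0 u0 vw uA h1 h2.
  apply: le_trans (lerD h2 h1).
  apply: (@le_trans _ _ (u ^+ 2 + v ^+ 2)); first by nra.
  by apply: lerD; rewrite ler_pXn2r ?nnegrE//; exact: le_trans uA || exact: le_trans vw.
exact: Im'.
Qed.

Let cross_mean t :
  has_mean P (fun z => ((A *m e t z)^T *m Q *m w t z) 0 0 +
                       ((w t z)^T *m Q *m (A *m e t z)) 0 0) 0.
Proof.
rewrite -[X in has_mean _ _ X]addr0; apply: has_meanD.
  have -> : 0 = \sum_(i < n) \sum_(j < n) Q i j * 0 :> R.
    by rewrite big1// => i _; rewrite big1// => j _; rewrite mulr0.
  apply: (eq_has_mean (f := fun z =>
      \sum_i \sum_j Q i j * ((A *m e t z) i 0 * w t z j 0))).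
    by move=> z; rewrite bilinear_sum.
  apply: has_mean_sum => i; apply: has_mean_sum => j; exact/has_meanZ/cross.
have -> : 0 = \sum_(i < n) \sum_(j < n) Q i j * 0 :> R.
  by rewrite big1// => i _; rewrite big1// => j _; rewrite mulr0.
apply: (eq_has_mean (f := fun z =>
    \sum_i \sum_j Q i j * ((A *m e t z) j 0 * w t z i 0))).
  move=> z; rewrite bilinear_sum.
  by apply: eq_bigr => i _; apply: eq_bigr => j _; rewrite [w _ _ _ _ * _]mulrC.
apply: has_mean_sum => i; apply: has_mean_sum => j; exact/has_meanZ/cross.
Qed.

Let mquad (f : T -> 'cV[R]_n) : measurable_fun setT f ->
  measurable_fun setT (fun z => quad_form Q (f z)).
Proof.
move=> mf; rewrite /quad_form; under eq_fun do rewrite bilinear_sum.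
apply: measurable_sum => i; apply: measurable_sum => j.
by apply: measurable_funM => //; apply: measurable_funM; exact: mcoord.
Qed.

Let error_quad t : exists m, has_mean P (fun z => quad_form Q (A *m e t z)) m.
Proof.
have [m em] := e_sqr t.
apply: (dominated_has_mean _ (has_meanZ (k * a ^+ 2) em)) => [|z].
  exact/mquad/measurable_mulmx.
rewrite ger0_norm//; apply: le_trans (Qk _) _.
by rewrite -mulrA ler_wpM2l.
Qed.

(** Of the [N.+1] terms, the first is the cost of the initial state, whose mean [m0] does not depend
    on [N]. Each of the others has mean [tau] plus the nonnegative cost of the propagated error; the
    cross terms vanish. *)
Let total_cost_mean : exists m0 : R, forall N, exists m,
  has_mean P (fun z => \sum_(0 <= t < N.+1) quad_form Q (x t z)) m /\
  N%:R * \tr (Q *m Sigma) <= m <= m0 + N%:R * \tr (Q *m Sigma) +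
    k * a ^+ 2 * (4 * (L ^+ 2 / K ^+ 2 + mu0 * L `^ (2 - p) + N%:R * gap)).
Proof.
set tau := \tr _.
have /choice[v hv] := error_quad.
have v0 t : 0 <= v t by apply: (has_mean_ge0 (hv t)).
have [m0 hm0] : exists m0, has_mean P (fun z => quad_form Q (x0 z)) m0.
  apply: (dominated_has_mean _
    (has_meanZ k (has_meanD (has_mean_cst P 1) x0_mu))) => [|z].
    exact/mquad/mRV.
  rewrite ger0_norm//; apply: le_trans (Qk _) _; rewrite ler_wpM2l//=.
  by rewrite -powR_mulrn//; apply: powR_ge_le1D => //; exact: ltW.
have m00 : 0 <= m0 by exact: has_mean_ge0 hm0 _.
exists m0 => N; exists (m0 + \sum_(0 <= t < N) (v t + tau)); split.
  apply: (eq_has_mean (f := fun z => quad_form Q (x0 z) +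
      \sum_(0 <= t < N) (quad_form Q (A *m e t z) + quad_form Q (w t z) +
        (((A *m e t z)^T *m Q *m w t z) 0 0 +
         ((w t z)^T *m Q *m (A *m e t z)) 0 0)))).
    move=> z; rewrite big_nat_recl//= /x state0; congr (_ + _).
    by apply: eq_bigr => t _; rewrite /S zoom_stateS// quad_formD.
  apply: has_meanD => //; apply: has_mean_sum => t.
  rewrite -[X in has_mean _ _ X]addr0.
  by apply: has_meanD => //; exact: has_meanD.
have -> : \sum_(0 <= t < N) (v t + tau) = \sum_(0 <= t < N) v t + N%:R * tau.
  by rewrite big_split/= sumr_const_nat subn0 [in RHS]mulr_natl.
have V0 : 0 <= \sum_(0 <= t < N) v t by exact: sumr_ge0.
have : \sum_(0 <= t < N) v t <=
    k * a ^+ 2 * (4 * (L ^+ 2 / K ^+ 2 + mu0 * L `^ (2 - p) + N%:R * gap)).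
  apply: (has_mean_le (has_mean_sum (index_iota 0 N) hv)
    (has_meanZ (k * a ^+ 2) (error_bound_mean N))) => z.
  apply: (@le_trans _ _ (k * a ^+ 2 * \sum_(0 <= t < N) `|e t z| ^+ 2)).
    rewrite mulr_sumr; apply: ler_sum => t _; apply: le_trans (Qk _) _.
    by rewrite -mulrA ler_wpM2l.
  by apply: ler_wpM2l; [rewrite mulr_ge0 ?sqr_ge0|exact: sum_error_le].
by move=> Vle; apply/andP; split; lra.
Qed.

Lemma zoom_cost :
  ((\tr (Q *m Sigma))%:E <= average_cost A B Q x0 w S)%E /\
  (average_cost A B Q x0 w S <= (\tr (Q *m Sigma) +
     4 * k * a ^+ 2 * (L ^+ 2 / K ^+ 2 + 2 `^ p * mu * L `^ (2 - p)))%:E)%E.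
Proof.
rewrite -/gap; have [m0 H] := total_cost_mean; set tau := \tr _ in H *.
rewrite /average_cost; split.
  (* The lower bound is [N * tau / N.+1], that is [tau - tau / N.+1]. *)
  rewrite -(limn_esup_affine tau (- tau)); apply: le_limn_esup => -[//|N] _.
  have [m [[_ ->] /andP[ml _]]] := H N.
  rewrite -EFinM lee_fin; have N0 : 0 < N.+1%:R :> R by rewrite ltr0n.
  rewrite [leLHS](_ : _ = N.+1%:R^-1 * (N%:R * tau)).
    by rewrite ler_wpM2l ?invr_ge0.
  by rewrite -natr1 in N0 *; field; rewrite gt_eqF.
set D := 4 * k * a ^+ 2 * gap; set c0 := L ^+ 2 / K ^+ 2 + mu0 * L `^ (2 - p).
(* The coefficient comes from writing [N] as [N.+1 - 1] in the upper bound, which then is exactly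
   affine in [1 / N.+1]. *)
rewrite -(limn_esup_affine (tau + D) (m0 + 4 * k * a ^+ 2 * c0 - tau - D)).
apply: le_limn_esup => -[//|N] _.
have [m [[_ ->] /andP[_ mu_]]] := H N.
rewrite -EFinM lee_fin; have N0 : 0 < N.+1%:R :> R by rewrite ltr0n.
apply: (@le_trans _ _ (N.+1%:R^-1 * (m0 + N%:R * tau +
    k * a ^+ 2 * (4 * (c0 + N%:R * gap))))).
  by rewrite ler_wpM2l ?invr_ge0.
rewrite le_eqVlt; apply/orP; left; apply/eqP.
by rewrite /D -natr1 in N0 *; field; rewrite gt_eqF.
Qed.

End zoom_cost.

(** * Choice of the parameters *)

Lemma finite_encoding (F : finType) N : (#|F| <= N)%N -> (0 < #|F|)%N ->
  exists (g : F -> 'I_N) (h : 'I_N -> F), cancel g h.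
Proof.
move=> FN /card_gt0P[f0 _].
pose g o := widen_ord FN (enum_rank o).
(* Symbols outside the image of [g] are decoded to the arbitrary [f0]. *)
exists g, (fun m => odflt f0 [pick o | g o == m]) => o.
case: pickP => [i /eqP gi|/(_ o)]; last by rewrite eqxx.
by apply: enum_rank_inj; apply: val_inj; exact: (congr1 val gi).
Qed.

Section parameters.
Context {R : realType}.
Implicit Types C D : R.

Lemma powR2_unbounded (D : R) : exists y, forall y', y <= y' -> D <= 2 `^ y'.
Proof.
exists (Num.truncn D).+1%:R => y' yy'.
apply: le_trans (ltW (truncnS_gt D)) _.
apply: (@le_trans _ _ (2 `^ (Num.truncn D).+1%:R)); last first.
  by apply: ler_powR => //; rewrite ler1n.
by rewrite powR_mulrn// -natrX ler_nat ltnW// ltn_expl.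
Qed.

(** One spare cell per axis leaves room for the overflow symbol: [K ^ n + 1 <= K.+1 ^ n], which is
    at most the real number whose floor is the alphabet size. *)
Lemma grid_fits (C : R) n K : (0 < n)%N -> K.+1%:R <= 2 `^ (C / n%:R) ->
  (#|{: option {ffun 'I_n -> 'I_K}}| <= alphabet_size C)%N.
Proof.
move=> n0 Ks; rewrite card_option card_ffun !card_ord /alphabet_size.
rewrite truncn_ge_nat ?powR_ge0//.
apply: (@le_trans _ _ (K.+1 ^ n)%:R); first by rewrite ler_nat ltn_exp2r.
have -> : 2 `^ C = (2 `^ (C / n%:R)) ^+ n.
  by rewrite -powR_mulrn ?powR_ge0// -powRrM divfK// pnatr_eq0 -lt0n.
by rewrite natrX; apply: lerXn2r; rewrite ?nnegrE ?powR_ge0.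
Qed.

Lemma width_ratio (K p : R) : 0 < K -> 0 < p ->
  (K `^ (2 / p)) ^+ 2 / K ^+ 2 = K `^ (4 / p - 2).
Proof.
move=> K0 p0; rewrite powRB; last by rewrite (gt_eqF K0) implybT.
rewrite -powR_mulrn ?powR_ge0// -powRrM powR_mulrn ?ltW//.
by congr (_ `^ _ / _); field; rewrite gt_eqF.
Qed.

Lemma width_tail (K p : R) : 0 < p ->
  (K `^ (2 / p)) `^ (2 - p) = K `^ (4 / p - 2).
Proof.
by move=> p0; rewrite -powRrM; congr (_ `^ _); field; rewrite gt_eqF.
Qed.

(** The exponent [4 / p - 2] is negative, so the lower bound on [K] gives an upper bound on the
    power. The factor [1 / 2] in it costs at most [2 ^ 2 = 4], and passing from [p] to the smaller
    [r] raises the exponent of a base at least 1. *)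
Lemma rate_le (K p r C n : R) : 2 < r -> r <= p -> 0 < n -> 0 <= C ->
  2 `^ (C / n) / 2 <= K ->
  K `^ (4 / p - 2) <= 4 * (2 `^ (4 / r * (1 / n) * C) / 2 `^ (2 / n * C)).
Proof.
move=> r2 rp n0 C0 sK.
have p0 : 0 < p by lra.
have r0 : 0 < r by lra.
have pr : 4 / p <= 4 / r by rewrite ler_pM2l// lef_pV2.
have r42 : 4 / r <= 2 by rewrite ler_pdivrMr//; lra.
have p40 : 0 <= 4 / p by rewrite divr_ge0// ltW.
apply: (@le_trans _ _ ((2 `^ (C / n) / 2) `^ (4 / p - 2))).
  apply: ler0_powR => //; first lra.
rewrite powRM ?powR_ge0// mulrC; apply: ler_pM; rewrite ?powR_ge0//.
  rewrite -powR_inv1// -powRrM.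
  apply: (@le_trans _ _ (2 `^ 2%:R)); last by rewrite powR_mulrn//; lra.
  by apply: ler_powR; [rewrite ler1n|lra].
rewrite -powRB ?pnatr_eq0 ?implybT// -powRrM.
apply: ler_powR; first by rewrite ler1n.
rewrite [leRHS](_ : _ = C / n * (4 / r - 2)); last by field; rewrite !gt_eqF.
by rewrite ler_wpM2l ?divr_ge0 ?(ltW n0)//; lra.
Qed.

End parameters.
Theorem mainTheorem1 (R : realType) (d : measure_display)
    (Omega : measurableType d) (P : probability Omega R)
    (n : nat) (A B Q Sigma : 'M[R]_n)
    (x0 : {RV P >-> 'cV[R]_n}) (w : nat -> {RV P >-> 'cV[R]_n}) (beta : R) :
  (0 < n)%N ->
  B \in unitmx ->
  posdefmx Q ->
  iid w ->
  zero_mean (w 0%N) ->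
  has_covariance (w 0%N) Sigma ->
  has_positive_density (w 0%N) ->
  2 < beta ->
  finite_moment beta (w 0%N) ->
  independent_of_family x0 w ->
  finite_moment beta x0 ->
  forall eps : R, 0 < eps < beta - 2 ->
  exists f : R -> R,
    (\forall C \near +oo_R, exists S : scheme R 'I_(alphabet_size C) n,
      (f C)%:E =
        (average_cost A B Q x0 w S
         - (\tr (Q *m Sigma))%:E)%E) /\
    bigO_pinfty f (fun C =>
      2 `^ (4 / (beta - eps) * (1 / n%:R) * C) / 2 `^ (2 / n%:R * C)).

Proof.
move=> n0 Bu [_ Qpos] w_iid w_mean w_cov _ beta2 w_mom x0_indep x0_mom.
move=> eps /andP[eps0 epsb].
have Q0 v : 0 <= quad_form Q v.
  have [->|/Qpos/ltW//] := eqVneq v 0.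
  by rewrite /quad_form mulmx0 mxE.
have [a a1 Aa] := mulmx_bounded A.
have [k k0 Qk] := quad_form_bounded Q.
have [rho rho2 rhop] := zoom_factor_exists beta2 a1.
have moment (X : {RV P >-> 'cV[R]_n}) : finite_moment beta X ->
    exists m, has_mean P (fun z => `|X z| `^ beta) m.
  move=> Xoo; apply: ge0_has_mean Xoo => [|z]; last exact: powR_ge0.
  apply: (measurableT_comp (measurable_powR beta)).
  exact: (measurableT_comp (@measurable_mx_norm R n 1)).
have [mu w_mu] := moment _ w_mom; have [mu0 x0_mu] := moment _ x0_mom.
have mu_ge0 : 0 <= mu by apply: (has_mean_ge0 w_mu) => z; exact: powR_ge0.
(* The last factor [4] is the constant of [rate_le]; the summand [1] makes [c] positive even if the
   rest vanishes. *)
pose c := 4 * k * a ^+ 2 * (1 + 2 `^ beta * mu) * 4 + 1.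
have D0 : 0 <= 4 * k * a ^+ 2 * (1 + 2 `^ beta * mu).
  have b1 : 0 <= 1 + 2 `^ beta * mu by rewrite addr_ge0// mulr_ge0// powR_ge0.
  by rewrite mulr_ge0// mulr_ge0 ?sqr_ge0// mulr_ge0.
have c0 : 0 < c by rewrite /c; lra.
pose rate C : R := 2 `^ (4 / (beta - eps) * (1 / n%:R) * C) / 2 `^ (2 / n%:R * C).
have nR : 0 < n%:R :> R by rewrite ltr0n.
(* Rounding loses less than 2 in passing from [s] to [K]. The margin [4] thus still gives
   [2 * a * rho <= K] and [s / 2 <= K]. *)
have [y0 y0P] := powR2_unbounded (2 * a * rho + 4).
pose C0 := Num.max 0 (y0 * n%:R).
(* The threshold stands inside the existential, so that choice over all [C] yields a total function;
   its value at or below [C0] is immaterial. *)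
have main C : exists v : R, C0 < C ->
    (exists S : scheme R 'I_(alphabet_size C) n,
      v%:E = (average_cost A B Q x0 w S - (\tr (Q *m Sigma))%:E)%E) /\
    0 <= v <= c * rate C.
  have [C0C|] := ltP C0 C; last by exists 0.
  have [Cge0 Cy0] : 0 <= C /\ y0 * n%:R <= C.
    by move: C0C; rewrite gt_max => /andP[/ltW ? /ltW ?].
  have := y0P (C / n%:R); rewrite ler_pdivlMr// => /(_ Cy0).
  set s := 2 `^ _ => sge.
  have arho : 0 <= a * rho by rewrite mulr_ge0//; lra.
  have s0 : 0 <= s by exact: powR_ge0.
  (* [K] is one less than the floor of [s], the room that [grid_fits] asks for. *)
  have [K KE] : exists K, Num.truncn s = K.+1.
    exists (Num.truncn s).-1; rewrite prednK// truncn_gt0; lra.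
  have Ks : K.+1%:R <= s by rewrite -KE truncn_le.
  have sK : s < K%:R + 2.
    by have := truncnS_gt s; rewrite KE -!natr1; lra.
  have KR : 0 < K%:R :> R by lra.
  have K0 : (0 < K)%N by rewrite -(ltr0n R).
  have [|g [h gK]] := finite_encoding (grid_fits n0 Ks).
    by rewrite card_option.
  pose L : R := K%:R `^ (2 / beta).
  have L0 : 0 < L by exact: powR_gt0.
  have Krho : 2 * a * rho <= K%:R by lra.
  have [lo hi] := zoom_cost gK Bu Aa beta2 a1 rho2 L0 rhop Krho
    (fun x => grid_cover K0) Q0 k0 Qk w_iid w_mean w_cov x0_indep w_mu x0_mu.
  set S := zoom_scheme _ _ _ _ _ _ _ _ in lo hi.
  have fin : average_cost A B Q x0 w S \is a fin_num.
    by rewrite fin_numE; move: lo hi; case: average_cost.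
  exists (fine (average_cost A B Q x0 w S) - \tr (Q *m Sigma)) => _; split.
    by exists S; rewrite EFinB fineK.
  move: lo hi; rewrite -(fineK fin) !lee_fin => lo hi.
  apply/andP; split; first by rewrite subr_ge0.
  have b0 : 0 < beta by lra.
  have := @rate_le R K%:R beta (beta - eps) C n%:R.
  move: hi; rewrite /L width_ratio// width_tail// -/(rate C).
  set G := K%:R `^ _ => hi GP.
  have {}GP : G <= 4 * rate C by apply: GP => //; rewrite -?/s; lra.
  have rate0 : 0 <= rate C by rewrite divr_ge0 ?powR_ge0.
  have : 4 * k * a ^+ 2 * (1 + 2 `^ beta * mu) * G <=
         4 * k * a ^+ 2 * (1 + 2 `^ beta * mu) * (4 * rate C).
    exact: ler_wpM2l.
  move: hi; rewrite /c; move: (2 `^ beta) => b hi h2.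
  have -> : (4 * k * a ^+ 2 * (1 + b * mu) * 4 + 1) * rate C =
    4 * k * a ^+ 2 * (1 + b * mu) * (4 * rate C) + rate C by ring.
  apply: le_trans (le_trans h2 _); last by rewrite lerDl.
  rewrite lerBlDl; apply: le_trans hi _; rewrite lerD2l le_eqVlt.
  by apply/orP; left; apply/eqP; ring.
have [f fP] := choice main.
exists f; split.
  by exists C0; split; [exact: num_real|move=> C /fP[]].
exists c => //; exists C0; split; first exact: num_real.
by move=> C /fP[].
Qed.
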